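(* For any dimension $n$ and any subdivision method $\Phi$ which is nontrivial in dimension $n$, there exists a unique ''limit polynomial'' $p_{n,\Phi}(t)$ such that, for any finite $n$-dimensional simplicial complex $X$, the roots of $f^{\Phi^k(X)}(t)$ converge to the roots of $p_{n,\Phi}(t)$ as $k$ increases. The roots of $p_{n,\Phi}(t)$ are invariant under the Möbius transformation $x\mapsto\frac{-x}{x+1}$.
   Context: For a finite simplicial complex $X$ of dimension $d-1$, $f^X_i$ is the number of $i$-dimensional faces of $X$, with $f^X_{-1}=1$ (the empty face), and the $f$-polynomial of $X$ is $f^X(t)=\sum_{j=0}^d f^X_{j-1}t^{d-j}$. A subdivision (not necessarily barycentric) of a simplicial complex $X$ is a simplicial complex $\widetilde X$ whose vertices are points of the geometric realization $|X|$ and such that (1) for every simplex $\widetilde\sigma$ of $\widetilde X$ there is a simplex $\sigma$ of $X$ with $\widetilde\sigma\subseteq|\sigma|$, and (2) the linear map $|\widetilde X|\to|X|$ mapping each vertex of $\widetilde X$ to the corresponding point of $|X|$ is a homeomorphism. A subdivision of $X$ is identified with the triple $(X,\widetilde X,\phi)$, where $\phi:\widetilde X\to X$ associates to each $\widetilde\sigma$ the smallest simplex $\sigma\in X$ such that $\widetilde\sigma\subseteq|\sigma|$. A subdivision method $\Phi$ is a collection of subdivisions $\Phi=\{(\sigma_m,\widetilde\sigma_m,\phi_m)\}_{m\ge0}$, where $\sigma_m$ is the standard $m$-simplex, such that for every map $i_k:\sigma_k\to\sigma_m$ identifying a $k$-face of the standard $m$-simplex and every permutation $\pi$ of the vertices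 of $\sigma_m$, the map $\phi_k$ is the restriction of $\phi_m$ to $\pi i_k(\sigma_k)$. This ensures that, for any simplicial complex $X$, the complex $\Phi(X)$ (the subdivision of $X$ according to the rule $\Phi$) is uniquely defined by requiring that every $m$-simplex of $X$ is subdivided as $(\sigma_m,\widetilde\sigma_m,\phi_m)$. $\Phi^k(X)$ denotes the result of applying $\Phi$ to $X$ repeatedly, $k$ times. $\Phi$ is nontrivial in dimension $n$ if $\phi_k$ is not the identity map for some $k\le n$. *)

(* Defs.v *)
From HB Require Import structures.
From mathcomp Require Import all_boot all_order all_algebra perm finmap complex.
From mathcomp Require Import all_classical all_reals all_analysis.

Set Implicit Arguments.
Unset Strict Implicit.
Unset Printing Implicit Defensive.

Import Order.TTheory GRing.Theory Num.Theory.
Import numFieldNormedType.Exports.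

Local Open Scope classical_set_scope.
Local Open Scope ring_scope.

(* Finite abstract simplicial complexes, the empty face being included. *)
Record complex (V : choiceType) := Complex {
  faces : {fset {fset V}};
  complex_fset0 : fset0 \in faces;
  complex_down : forall s t : {fset V},
    (t `<=` s)%fset -> s \in faces -> t \in faces }.

Definition vertices (V : choiceType) (X : complex V) : {fset V} :=
  (\bigcup_(s <- faces X) s)%fset.

(* dimS X = dim X + 1, the number called d in the f-polynomial. *)
Definition dimS (V : choiceType) (X : complex V) : nat :=
  (\max_(s <- faces X) #|` s|)%N.

(* fnum X j is f_(j-1): faces are counted by their number of vertices. *)
Definition fnum (V : choiceType) (X : complex V) (j : nat) : nat :=
  #|` [fset s in faces X | #|` s| == j]%fset |.

Lemma full_simplex_fset0 (V : choiceType) (A : {fset V}) :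
  fset0 \in fpowerset A.
Proof. by rewrite fpowersetE fsub0set. Qed.

Lemma full_simplex_down (V : choiceType) (A s t : {fset V}) :
  (t `<=` s)%fset -> s \in fpowerset A -> t \in fpowerset A.
Proof. by rewrite !fpowersetE; exact: fsubset_trans. Qed.

Definition full_simplex (V : choiceType) (A : {fset V}) : complex V :=
  Complex (full_simplex_fset0 A) (@full_simplex_down V A).

Definition std_simplex (m : nat) : complex 'I_m.+1 :=
  full_simplex [fset i | i in 'I_m.+1]%fset.

(* Points of a geometric realization are given by their barycentric
   coordinates.  On the realization of a finite complex the topology of
   pointwise convergence is the usual one. *)
Notation point R V := {ptws V -> R}.

Section Subdivision.
Variable R : realType.

Definition closed_simplex (V : choiceType) (s : {fset V}) : set (point R V) :=
  [set x | [/\ forall v, 0 <= x v,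
               forall v, v \notin s -> x v = 0
             & \sum_(v <- s) x v = 1]].

Definition realization (V : choiceType) (X : complex V) : set (point R V) :=
  [set x | exists2 s, s \in faces X & closed_simplex s x].

Definition homeomorphism (T U : topologicalType) (A : set T) (B : set U)
    (f : T -> U) : Prop :=
  [/\ set_bij A B f,
      {within A, continuous f}
    & exists g : U -> T,
        {in A, cancel f g} /\ {within B, continuous g}].

Definition dirac_point (V : choiceType) (v : V) : point R V :=
  fun w => (w == v)%:R.

(* The linear map from |Y| sending each vertex of Y, itself a point with
   coordinates in V, to that point. *)
Definition linear_map (V : choiceType) (Y : complex (point R V))
    (y : point R (point R V)) : point R V :=
  fun v => \sum_(x <- vertices Y) y x * x v.

Definition inside (V : choiceType) (s : {fset point R V}) (t : {fset V}) :=
  forall x, x \in s -> closed_simplex t x.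

Definition is_subdivision (V : choiceType) (X : complex V)
    (Y : complex (point R V)) : Prop :=
  [/\ forall x, x \in vertices Y -> realization X x,
      forall s, s \in faces Y -> exists2 t, t \in faces X & inside s t
    & homeomorphism (realization Y) (realization X) (linear_map Y)].

(* The map phi of the subdivision: the smallest face t of X with s inside |t|
   (fset0 is a dummy value when there is none). *)
Definition carrier (V : choiceType) (X : complex V) (s : {fset point R V}) :
    {fset V} :=
  xget fset0 [set t | [/\ t \in faces X, inside s t
    & forall t', t' \in faces X -> inside s t' -> (t `<=` t')%fset]].

(* Affine map on points induced by a map of vertices. *)
Definition push (I : finType) (V : choiceType) (h : I -> V) (x : point R I) :
    point R V :=
  fun v => \sum_(i | h i == v) x i.

Definition push_face (I : finType) (V : choiceType) (h : I -> V)
    (s : {fset point R I}) : {fset point R V} :=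
  [fset push h x | x in s]%fset.

(* method_restr: along the identification h of std_simplex k with a face of
   std_simplex m, the restriction of the carrier map phi_m to that face
   (faces of the subdivision lying over it, and their carriers) is phi_k. *)
Record subdivision_method := SubdivisionMethod {
  method_complex :> forall m : nat, complex (point R 'I_m.+1);
  method_subdivision : forall m : nat,
    is_subdivision (std_simplex m) (method_complex m);
  method_restr : forall (k m : nat) (i : 'I_k.+1 -> 'I_m.+1) (pi : 'S_m.+1),
    injective i ->
    let h := fun a => pi (i a) in
    let F := [fset h a | a in 'I_k.+1]%fset in
    (forall s, s \in faces (method_complex k) ->
       push_face h s \in faces (method_complex m) /\
       carrier (std_simplex m) (push_face h s) =
         [fset h a | a in carrier (std_simplex k) s]%fset) /\
    (forall s, s \in faces (method_complex m) ->
       (carrier (std_simplex m) s `<=` F)%fset ->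
       exists2 s', s' \in faces (method_complex k) & s = push_face h s') }.

(* phi_k is the identity when every face of the subdivision equals its carrier,
   a vertex of the simplex being identified with the corresponding point. *)
Definition nontrivial_method (Phi : subdivision_method) (n : nat) : Prop :=
  exists2 k : nat, (k <= n)%N &
    ~ (forall s, s \in faces (Phi k) ->
         s = [fset dirac_point a | a in carrier (std_simplex k) s]%fset).

Section Apply.
Variables (Phi : subdivision_method) (V : choiceType) (X : complex V).

(* All bijections h from {0..m} to the vertices of a face t with m+1 vertices
   are used; by method_restr they give the same subdivision of |t|.  (For
   t = fset0 there is no h.) *)
Definition subdivide_faces : {fset {fset point R V}} :=
  (fset0 |` \bigcup_(t <- faces X)
     \bigcup_(h | injectiveb (h : {ffun 'I_(#|` t|.-1).+1 -> t}))
       [fset push_face (fun i => fsval (h i)) s | s in faces (Phi #|` t|.-1)])%fset.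

Lemma subdivide_fset0 : fset0 \in subdivide_faces.
Proof. by rewrite /subdivide_faces in_fset1U eqxx. Qed.

Lemma subdivide_down (s t : {fset point R V}) :
  (t `<=` s)%fset -> s \in subdivide_faces -> t \in subdivide_faces.
Proof.
move=> ts; rewrite /subdivide_faces !in_fset1U => /orP[/eqP s0|].
  by move: ts; rewrite s0 fsubset0 => ->.
case/bigfcupP => u /andP[uX _] /bigfcupP[h /andP[_ hinj]] /imfsetP[/= r rF sE].
apply/orP; right; apply/bigfcupP; exists u; first by rewrite uX.
apply/bigfcupP; exists h; first by rewrite mem_index_enum.
pose g i := fsval (h i).
apply/imfsetP; exists [fset x in r | push g x \in t]%fset => /=.
  by apply: complex_down rF; apply/fsubsetP => x; rewrite !inE => /andP[].
apply/fsetP => y; apply/idP/imfsetP => /= [yt|[x]]; last first.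
  by rewrite !inE => /andP[_ ?] ->.
have := fsubsetP ts _ yt; rewrite sE => /imfsetP[/= x xr yE].
by exists x; rewrite // !inE xr -yE.
Qed.

Definition subdivide : complex (point R V) :=
  Complex subdivide_fset0 subdivide_down.

End Apply.

Fixpoint iter_vert (V : choiceType) (k : nat) : choiceType :=
  if k is k'.+1 then point R (iter_vert V k') else V.

Fixpoint subdivide_iter (Phi : subdivision_method) (V : choiceType)
    (X : complex V) (k : nat) : complex (iter_vert V k) :=
  if k is k'.+1 then subdivide Phi (subdivide_iter Phi X k') else X.

Definition Cx : numClosedFieldType := R[i].

Definition fpoly (V : choiceType) (X : complex V) : {poly Cx} :=
  \sum_(j < (dimS X).+1) (fnum X j)%:R *: 'X^(dimS X - j).

Definition sphere : topologicalType := one_point_compactification Cx.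

Definition finite_points (w : seq sphere) : seq Cx := pmap id w.

(* w lists, with multiplicity, the roots on the sphere of p <> 0 viewed as a
   polynomial of degree at most d: the point at infinity (None) is a root of
   multiplicity d - deg p. *)
Definition sphere_roots (d : nat) (p : {poly Cx}) (w : d.-tuple sphere) : Prop :=
  p %= \prod_(z <- finite_points w) ('X - z%:P).

Definition roots_converge (d : nat) (f : nat -> {poly Cx}) (p : {poly Cx}) :
    Prop :=
  exists (z : nat -> d.-tuple sphere) (w : d.-tuple sphere),
    [/\ forall k, sphere_roots (f k) (z k),
        sphere_roots p w
      & forall i : 'I_d, (fun k => tnth (z k) i) @ \oo --> tnth w i].

Definition limit_polynomial (n : nat) (Phi : subdivision_method)
    (p : {poly Cx}) : Prop :=
  forall (V : choiceType) (X : complex V), dimS X = n.+1 ->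
    roots_converge n.+1 (fun k => fpoly (subdivide_iter Phi X k)) p.

(* x |-> -x / (x + 1), with -1 |-> infinity |-> -1. *)
Definition mobius (x : sphere) : sphere :=
  match (x : option Cx) with
  | Some z => if z == -1 then None else Some (- z / (z + 1))
  | None => Some (-1)
  end.

End Subdivision.

(* Main.v *)
Require Import Defs.
From HB Require Import structures.
From mathcomp Require Import all_boot all_order all_algebra perm finmap complex.
From mathcomp Require Import all_classical all_reals all_analysis.
From mathcomp Require Import ring lra zify.

(** Let d = n + 1 and let X have dimension n.  Every face of the subdivision of X
    lies over a unique face of X, so the face numbers of the subdivision are the row
    of face numbers of X multiplied by a matrix L that depends only on the method:
    L i j is the number of interior faces with j vertices in the subdivided simplex
    on i vertices (fnum_subdivide).  L is lower triangular, and when the method is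
    nontrivial its last diagonal entry L d d, the number of facets of the subdivided
    n-simplex, is strictly larger than the others: a wall of the simplex has at most
    as many ridges as there are facets, with equality for all walls only if nothing
    is subdivided (nontrivial_diag_count).  Power iteration then shows that the face
    numbers of the k-th subdivision, divided by the top one, converge to the dominant
    left eigenvector v of L with v d = 1, whatever X is (face_ratio_cvg).  The limit
    polynomial is the sum of the v j * t ^ (d - j).

    Its top coefficient v 0 is zero, so some roots escape to infinity.  In the
    coordinate s = 1/t they do not: the reversed polynomials have degree exactly d and
    are monic after scaling.  Their roots depend continuously on the coefficients
    (monic_roots_continuous), and s |-> 1/s is continuous as a map to the sphere.
    Uniqueness holds because the sphere is separated (roots_converge_unique).

    In the coordinate s the Moebius transformation is the reflection s |-> - 1 - s.
    Invariance under it means that v is, up to sign, fixed by the matrix D of entries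
    (-1) ^ j * 'C(j, i).  D commutes with L (count_involution), so it preserves the
    dominant eigenline, and the last coordinate gives the scalar (-1) ^ d.

    Commutation is the statement that, in a subdivided simplex with N corners, the
    interior faces s containing a given face r satisfy
      sum over s of (-1) ^ |s| = (-1) ^ N   (interior_star_sum).
    This is proved with a generic vector q of the open orthant instead of homology.
    From each interior face, the direction - q enters a unique facet S.  For a fixed
    S the faces assigned to it form a Boolean interval, over which the signs cancel
    unless the interval is a point; and this happens for exactly one S containing r,
    the facet that the direction q enters from r. *)

Set Implicit Arguments.
Unset Strict Implicit.
Unset Printing Implicit Defensive.

Import Order.TTheory GRing.Theory Num.Theory.
Import numFieldNormedType.Exports.

Local Open Scope classical_set_scope.
Local Open Scope ring_scope.

Local Notation point R V := {ptws V -> R}.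
Local Notation complex := Defs.complex.

(** * Cones over the faces of a subdivided simplex *)

Section SubdividedSimplex.
Variables (R : realType) (m : nat).
Local Notation N := m.+1.
Local Notation pt := (point R 'I_N).

Lemma std_simplex_closed (x : pt) : realization (std_simplex m) x ->
  (forall i, 0 <= x i) /\ \sum_i x i = 1.
Proof.
case=> t _ [x0 xt x1]; split=> //.
rewrite -x1 [RHS](@big_fset_incl _ _ _ _ t [fset i | i in 'I_N]%fset).
- by rewrite big_imfset //= big_enum.
- by apply/fsubsetP=> i _; apply/imfsetP; exists i.
- by move=> i _ /xt.
Qed.

Lemma closed_std_simplex (x : pt) : (forall i, 0 <= x i) -> \sum_i x i = 1 ->
  realization (std_simplex m) x.
Proof.
move=> x0 x1; exists [fset i | i in 'I_N]%fset.
  by rewrite /= fpowersetE fsubset_refl.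
split=> // [i|]; first by case/negP; apply/imfsetP; exists i.
by rewrite big_imfset //= big_enum.
Qed.

Variable Y : complex pt.
Hypothesis subdivY : is_subdivision (std_simplex m) Y.

Lemma face_vertex (s : {fset pt}) x : s \in faces Y -> x \in s ->
  x \in vertices Y.
Proof. by move=> sY xs; apply/bigfcupP; exists s; rewrite ?sY. Qed.

Lemma face_sub_vertices (s : {fset pt}) : s \in faces Y ->
  (s `<=` vertices Y)%fset.
Proof. by move=> sY; apply/fsubsetP => x; exact: face_vertex. Qed.

Lemma vertex_ge0 x i : x \in vertices Y -> 0 <= x i.
Proof. by case: subdivY => H _ _ /H /std_simplex_closed[]. Qed.

Lemma vertex_coord_sum x : x \in vertices Y -> \sum_i x i = 1.
Proof. by case: subdivY => H _ _ /H /std_simplex_closed[]. Qed.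

Definition supported (s : {fset pt}) (a : point R pt) :=
  forall x, x \notin s -> a x = 0.

Lemma linear_map_supported (s : {fset pt}) a i :
  (s `<=` vertices Y)%fset -> supported s a ->
  linear_map Y a i = \sum_(x <- s) a x * x i.
Proof.
move=> sY sa; rewrite /linear_map; apply/esym/big_fset_incl => //.
by move=> x _ /sa ->; rewrite mul0r.
Qed.

Lemma linear_map_sum a : \sum_i linear_map Y a i = \sum_(x <- vertices Y) a x.
Proof.
rewrite exchange_big /=; apply: eq_big_seq => x xY.
by rewrite -big_distrr /= vertex_coord_sum // mulr1.
Qed.

Lemma linear_map_axpy a c b : linear_map Y (fun x => a x + c * b x) =
  (fun i => linear_map Y a i + c * linear_map Y b i).
Proof.
apply/funext=> i; rewrite /linear_map big_distrr -big_split /=.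
by apply: eq_bigr => x _; rewrite mulrDl mulrA.
Qed.

Lemma linear_mapZ c a : linear_map Y (fun x => c * a x) =
  (fun i => c * linear_map Y a i).
Proof.
apply/funext=> i; rewrite /linear_map big_distrr /=.
by apply: eq_bigr => x _; rewrite mulrA.
Qed.

Lemma supported_sum (s : {fset pt}) (a : point R pt) : s \in faces Y ->
  supported s a -> \sum_(x <- s) a x = \sum_(x <- vertices Y) a x.
Proof.
move=> sY sa; apply: big_fset_incl; first exact: face_sub_vertices.
by move=> x _ /sa ->.
Qed.

(** The realization of the subdivision covers the simplex; by homogeneity the cones
    over its faces cover the orthant.  Working with cones treats the empty face,
    whose cone is the origin, like any other. *)
Lemma cone_cover (y : pt) : (forall i, 0 <= y i) ->
  exists s a, [/\ s \in faces Y, supported s a, forall x, 0 <= a x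
    & linear_map Y a = y].
Proof.
move=> y0; have [ysum|ysum] := eqVneq (\sum_i y i) 0.
  exists fset0, (fun=> 0); split=> //; first exact: complex_fset0.
  apply/funext=> i; rewrite /linear_map big1 => [|x _]; last by rewrite mul0r.
  by apply/esym; apply: (psumr_eq0P _ ysum).
have y1 : realization (std_simplex m) (fun i => (\sum_i y i)^-1 * y i).
  apply: closed_std_simplex => [i|].
    by rewrite mulr_ge0 // invr_ge0 sumr_ge0.
  by rewrite -big_distrr /= mulVf.
case: subdivY => _ _ [[_ _ surj] _ _].
have [a [s sY [a0 sa _]] ay] := surj _ y1.
exists s, (fun x => (\sum_i y i) * a x); split=> //.
- by move=> x /sa ->; rewrite mulr0.
- by move=> x; rewrite mulr_ge0 // sumr_ge0.
- by rewrite linear_mapZ ay; apply/funext=> i; rewrite mulrA divff ?mul1r.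
Qed.

(** Injectivity of the map of realizations, again made homogeneous: both sides are
    rescaled by their common coordinate sum. *)
Lemma cone_unique (s t : {fset pt}) a b : s \in faces Y -> t \in faces Y ->
  supported s a -> supported t b -> (forall x, 0 <= a x) ->
  (forall x, 0 <= b x) -> linear_map Y a = linear_map Y b -> a = b.
Proof.
move=> sY tY sa tb a0 b0 ab.
pose T := \sum_(x <- vertices Y) a x.
have Tb : T = \sum_(x <- vertices Y) b x by rewrite /T -!linear_map_sum ab.
have [T0|T0] := eqVneq T 0.
  have vanish (c : point R pt) u : u \in faces Y -> supported u c ->
    (forall x, 0 <= c x) -> \sum_(x <- vertices Y) c x = 0 -> forall x, c x = 0.
    move=> uY uc c0 sc x; have [xY|xY] := boolP (x \in vertices Y); last first.
      by apply: uc; apply: contra xY; exact: face_vertex.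
    apply/eqP; rewrite eq_le c0 andbT -sc (big_fsetD1 x) //= lerDl.
    by rewrite sumr_ge0.
  apply/funext=> x; rewrite (vanish a s) // (vanish b t) //.
  by rewrite -Tb.
have Tgt0 : 0 < T by rewrite lt_neqAle eq_sym T0 sumr_ge0.
case: subdivY => _ _ [[_ inj _] _ _].
have /(congr1 (fun c : point R pt => fun x => T * c x)) :
    (fun x => T^-1 * a x) = (fun x => T^-1 * b x) :> point R pt.
  apply: inj; rewrite ?inE.
  - exists s => //; split=> [x|x /sa ->|]; rewrite ?mulr0 //.
      by rewrite mulr_ge0 // invr_ge0 ltW.
    by rewrite -big_distrr /= supported_sum // -/T mulVf.
  - exists t => //; split=> [x|x /tb ->|]; rewrite ?mulr0 //.
      by rewrite mulr_ge0 // invr_ge0 ltW.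
    by rewrite -big_distrr /= supported_sum // -Tb mulVf.
  - by rewrite !linear_mapZ ab.
by move=> /= /funeqP E; apply/funext => x; have := E x; rewrite !mulrA divff // !mul1r.
Qed.

(** The positive and negative parts of a linear relation between the vertices of a
    face have the same image, so they coincide. *)
Lemma face_free (s : {fset pt}) a : s \in faces Y -> supported s a ->
  linear_map Y a = (fun=> 0) -> a = (fun=> 0).
Proof.
move=> sY sa a0.
pose b x := Num.max (a x) 0; pose c x := Num.max (- a x) 0.
have abc x : a x = b x - c x.
  by rewrite /b /c -[X in Num.max (- _) X]oppr0 -oppr_min opprK addr_max_min addr0.
have bc : b = c.
  apply: (cone_unique sY sY).
  - by move=> x /sa; rewrite /b => ->; rewrite maxxx.
  - by move=> x /sa; rewrite /c => ->; rewrite oppr0 maxxx.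
  - by move=> x; rewrite /b le_max lexx orbT.
  - by move=> x; rewrite /c le_max lexx orbT.
  apply/funext => i; apply/eqP; rewrite -subr_eq0; apply/eqP.
  have /funeqP/(_ i) <- := a0; rewrite /linear_map -sumrB.
  by apply: eq_bigr => x _; rewrite abc mulrBl.
by apply/funext => x; rewrite abc bc subrr.
Qed.

Lemma face_coord_inj (s : {fset pt}) a b : s \in faces Y -> supported s a ->
  supported s b -> linear_map Y a = linear_map Y b -> a = b.
Proof.
move=> sY sa sb ab; have := @face_free s (fun x => a x - b x) sY.
move=> H; apply/funext => x; apply/eqP; rewrite -subr_eq0; apply/eqP.
suff /funeqP/(_ x) : (fun x => a x - b x) = (fun=> 0) by [].
apply: H => [y ys|]; first by rewrite sa ?sb ?subrr.
apply/funext => i; apply/eqP; rewrite -(subrr (linear_map Y a i)).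
rewrite {2}ab /linear_map -sumrB; apply/eqP; apply: eq_bigr => y _.
by rewrite mulrBl.
Qed.


Lemma left_kernel_tall (k l : nat) (A : 'M[R]_(k, l)) : (l < k)%N ->
  exists2 u : 'rV_k, u != 0 & u *m A = 0.
Proof.
move=> lk; have : kermx A != 0.
  rewrite -mxrank_eq0 mxrank_ker -lt0n subn_gt0.
  exact: leq_ltn_trans (rank_leq_col A) lk.
by case/rowV0Pn=> u /sub_kermxP uA u0; exists u.
Qed.

(** The vertices of a face are linearly independent. *)
Lemma leq_card_face (s : {fset pt}) : s \in faces Y -> (#|` s| <= N)%N.
Proof.
move=> sY; rewrite leqNgt; apply/negP => sN.
pose A : 'M[R]_(#|` s|, N) := \matrix_(k, i) (nth 0 s k : pt) i.
have [u u0 uA] := left_kernel_tall A sN; case/negP: u0; apply/eqP/rowP => k.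
pose a x := if insub (index x s) is Some k' then u 0 k' else 0.
have sa : supported s a.
  move=> x xs; rewrite /a; case: insubP => // k'.
  by rewrite index_mem (negPf xs).
have ank (k' : 'I_#|` s|) : a (nth 0 s k') = u 0 k'.
  by rewrite /a index_uniq ?fset_uniq // valK.
rewrite mxE -ank (face_free sY sa) //; apply/funext => i.
rewrite (linear_map_supported _ (face_sub_vertices sY)) //.
transitivity ((u *m A) 0 i); last by rewrite uA mxE.
rewrite (big_nth 0) big_mkord !mxE; apply: eq_bigr => k' _.
by rewrite ank !mxE.
Qed.

Definition generic (u : pt) := forall (t : {fset pt}) a,
  (t `<=` vertices Y)%fset -> (#|` t| <= m)%N -> supported t a ->
  linear_map Y a <> u.

(** A point of the moment curve with coordinates tau ^ i, for a suitable natural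
    number tau > 0: a vector annihilated by a nonzero linear form makes tau a root
    of a nonzero polynomial, so only finitely many values of tau are excluded. *)
Lemma ex_generic : exists2 q : pt, forall i, 0 < q i & generic q.
Proof.
have ann (t : {fset pt}) : exists2 P : {poly R}, P != 0 &
    forall tau a, (t `<=` vertices Y)%fset -> (#|` t| <= m)%N ->
    supported t a -> linear_map Y a = (fun i => tau ^+ i) -> root P tau.
  have [tm|] := leqP #|` t| m; last by exists 1; rewrite ?oner_eq0.
  pose A : 'M[R]_(N, #|` t|) := \matrix_(i, k) (nth 0 t k : pt) i.
  have [u u0 uA] := @left_kernel_tall _ _ A tm.
  exists (rVpoly u).
    by apply: contra u0 => /eqP E; rewrite -(rVpolyK u) E linear0.
  move=> tau a tY _ ta atau; apply/eqP; rewrite horner_poly.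
  transitivity (\sum_(i < N) u 0 i * linear_map Y a i).
    apply: eq_bigr => i _; rewrite atau; congr (_ * _).
    by case: insubP => [j _ /val_inj ->//|]; rewrite ltn_ord.
  under eq_bigr do rewrite (linear_map_supported _ tY ta) big_distrr.
  rewrite exchange_big /= big1_seq // => x /= xt.
  have ltx : (index x t < #|` t|)%N by rewrite index_mem.
  transitivity (a x * (u *m A) 0 (Ordinal ltx)); last by rewrite uA mxE mulr0.
  rewrite mxE big_distrr /=; apply: eq_bigr => i _.
  by rewrite mxE nth_index // mulrCA.
pose P t := s2val (cid2 (ann t)).
pose Q := \prod_(t <- fpowerset (vertices Y)) P t.
have Q0 : Q != 0.
  by rewrite prodf_seq_neq0; apply/allP => t _; rewrite /= /P; case: cid2.
have [k kQ] : exists k : nat, ~~ root Q k.+1%:R.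
  apply: contrapT => /forallNP H.
  have := @max_poly_roots _ Q [seq k.+1%:R | k <- iota 0 (size Q)] Q0.
  rewrite size_map size_iota ltnn => C; apply/notF/C.
    by apply/allP => _ /mapP[k _ ->]; apply: contrapT => /negP; exact: H.
  rewrite map_inj_uniq ?iota_uniq // => k l /eqP.
  by rewrite eqr_nat => /eqP[].
exists (fun i => k.+1%:R ^+ i) => [i|t a tY tm ta atau]; first by rewrite exprn_gt0.
case/negP: kQ; rewrite rootE horner_prod prodf_seq_eq0; apply/hasP; exists t => /=.
  by rewrite fpowersetE.
by rewrite /P; case: cid2 => p /= _; apply; eassumption.
Qed.

Lemma generic_coord_neq0 u (s : {fset pt}) c x : generic u -> s \in faces Y ->
  supported s c -> linear_map Y c = u -> x \in s -> c x != 0.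
Proof.
move=> gu sY sc cu xs; apply/eqP => cx; apply: (gu (s `\ x)%fset c) => //.
- by apply: fsubset_trans (face_sub_vertices sY); exact: fsubD1set.
- by have := leq_card_face sY; rewrite (cardfsD1 x) xs add1n ltnS.
- by move=> y; rewrite !inE negb_and negbK => /orP[/eqP->//|]; exact: sc.
Qed.

(** A chosen point in the relative interior of the cone over s. *)
Definition vertex_sum_of (s : {fset pt}) : pt :=
  linear_map Y (fun x => (x \in s)%:R).

(** Small displacements in direction u from a relatively interior point of the cone
    over s end in the open cone over the facet S.  In the coordinates c of u on the
    vertices of S, this says that the coordinates outside s are positive. *)
Definition enters (s : {fset pt}) (u : pt) (S : {fset pt}) :=
  [/\ S \in faces Y, #|` S| = N, (s `<=` S)%fset
    & exists c, [/\ supported S c, linear_map Y c = u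
                 & forall x, x \in S -> x \notin s -> 0 < c x]].

Lemma infinite_fiber (T : finType) (f : nat -> T) :
  exists t, forall M, exists2 k, (M <= k)%N & f k = t.
Proof.
apply: contrapT => /forallNP H.
have B t : exists M, forall k, (M <= k)%N -> f k <> t.
  have /existsNP[M HM] := H t; exists M => k Mk fk; apply: HM.
  by exists k.
have [M BM] := choice B.
apply: (BM (f (\max_t M t)) (\max_t M t)%N) => //.
exact: leq_bigmax.
Qed.

(** Among the points at distances e / (k + 1), infinitely many lie in the cone over
    the same face t.  Coordinates on t are affine functions of the displacement, so
    their values at displacement 0 are nonnegative and exhibit s as a face of t; the
    genericity of u makes t a facet. *)
Lemma enters_exists (s : {fset pt}) (u : pt) (e : R) : s \in faces Y -> generic u -> 0 < e ->
  (forall eps, 0 < eps <= e -> forall i, 0 <= vertex_sum_of s i + eps * u i) ->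
  exists S, enters s u S.
Proof.
move=> sY gu e0 ue.
pose eps k : R := e / k.+1%:R.
have eps0 k : 0 < eps k by rewrite divr_gt0.
have cover k : exists ta : faces Y * point R pt,
   [/\ supported (val ta.1) ta.2, forall x, 0 <= ta.2 x
     & linear_map Y ta.2 = fun i => vertex_sum_of s i + eps k * u i].
  have [|t [a [tY ta a0 la]]] := @cone_cover (fun i => vertex_sum_of s i + eps k * u i).
    apply: ue; rewrite eps0 ler_pdivrMr // ler_peMr ?(ltW e0) //.
    by rewrite ler1n.
  by exists ([` tY]%fset, a).
have [f Hf] := choice cover.
have [[t tY] often] := infinite_fiber (fun k => (f k).1).
have coord k : (f k).1 = FSetSub tY -> [/\ supported t (f k).2,
     forall x, 0 <= (f k).2 x
     & linear_map Y (f k).2 = fun i => vertex_sum_of s i + eps k * u i].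
  by have := Hf k; case: (f k) => t' a /= + t'E; rewrite t'E.
have [k _ fk] := often 0; have [l kl fl] := often k.+1.
have [ta a0 la] := coord _ fk; have [tb b0 lb] := coord _ fl.
have ekl : eps k - eps l != 0.
  rewrite subr_eq0; apply/eqP => /(mulfI (lt0r_neq0 e0))/invr_inj/eqP.
  by rewrite eqr_nat; lia.
(* c and d: slope and value at 0 of the affine coordinates on t. *)
pose c x := (eps k - eps l)^-1 * ((f k).2 x + -1 * (f l).2 x).
have tc : supported t c by move=> x xt; rewrite /c ta // tb //; lra.
have lc : linear_map Y c = u.
  rewrite linear_mapZ linear_map_axpy la lb; apply/funext => i.
  by rewrite /=; field.
pose d x := (f k).2 x + - eps k * c x.
have td : supported t d by move=> x xt; rewrite /d ta // tc //; lra.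
have ld : linear_map Y d = vertex_sum_of s.
  by rewrite linear_map_axpy la lc; apply/funext => i; lra.
have dc l' : (f l').1 = FSetSub tY -> forall x, 0 <= d x + eps l' * c x.
  move=> /coord[t' a' l'E] x; rewrite (_ : _ + _ = (f l').2 x) //.
  apply/esym; move: x; apply/funeqP; apply: (face_coord_inj tY) => //.
    by move=> y yt; rewrite td // tc //; lra.
  by rewrite linear_map_axpy ld lc.
have d0 x : 0 <= d x.
  rewrite leNgt; apply/negP => dx.
  have Mb : 0 <= e * `|c x| / - d x.
    by rewrite divr_ge0 ?mulr_ge0 ?(ltW e0) // oppr_ge0 ltW.
  have [l' Ml' /dc/(_ x)] := often (Num.bound (e * `|c x| / - d x)).
  apply/negP; rewrite -ltNge -ltrBDl sub0r.
  have : eps l' * c x <= e * `|c x| / l'.+1%:R.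
    by rewrite mulrAC ler_pM2r ?invr_gt0 // ler_pM2l // ler_norm.
  move=> /le_lt_trans; apply; rewrite ltr_pdivrMr // [ltRHS]mulrC -ltr_pdivrMr ?oppr_gt0 //.
  apply: lt_le_trans (archi_boundP Mb) _.
  by rewrite ler_nat; apply: leq_trans Ml' _.
have dE : d = (fun x => (x \in s)%:R).
  apply: (cone_unique tY sY) => // x.
  by move/negPf ->.
have st : (s `<=` t)%fset.
  apply/fsubsetP => x xs; apply: contraT => /td.
  by rewrite dE xs => /eqP; rewrite oner_eq0.
have cn0 x : x \in t -> c x != 0 by exact: (generic_coord_neq0 gu tY).
exists t; split => //.
  apply/eqP; rewrite eqn_leq leq_card_face // ltnNge; apply/negP => tm.
  by apply: (gu t c) => //; exact: face_sub_vertices.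
exists c; split=> // x xt xs; rewrite lt_def cn0 //=.
by have := dc _ fk x; rewrite dE (negPf xs) add0r pmulr_rge0.
Qed.

(** Close to the starting point the coordinates on s stay positive by continuity, and
    those outside s are positive by definition. *)
Lemma enters_nearby (s : {fset pt}) (u : pt) (S : {fset pt}) : enters s u S ->
  exists2 e, 0 < e & forall eps, 0 < eps <= e -> exists a : point R pt,
    [/\ supported S a, forall x, x \in S -> 0 < a x
      & linear_map Y a = fun i => vertex_sum_of s i + eps * u i].
Proof.
move=> [SY _ sS [c [Sc cu c0]]].
(* |c x| < M, so displacements up to 1 / M keep the coordinates on s positive. *)
pose M := 1 + \sum_(x <- S) `|c x|.
have M0 : 0 < M by rewrite ltr_pwDl // sumr_ge0.
exists M^-1; first by rewrite invr_gt0.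
move=> eps /andP[eps0 epsM]; exists (fun x => (x \in s)%:R + eps * c x); split.
- move=> x xS; rewrite Sc // mulr0 addr0.
  by case: (boolP (x \in s)) => // /(fsubsetP sS); rewrite (negPf xS).
- move=> x xS; have [xs|xs] := boolP (x \in s); last first.
    by rewrite add0r mulr_gt0 // c0.
  have cM : `|c x| < M.
    by rewrite /M (big_fsetD1 x) //= addrCA ltrDl ltr_pwDl // sumr_ge0.
  have : - (eps * c x) <= eps * `|c x| by rewrite -mulrN ler_pM2l // -normrN ler_norm.
  have : eps * `|c x| < M^-1 * M.
    by apply: (@le_lt_trans _ _ (M^-1 * `|c x|)); rewrite ?ler_wpM2r // ltr_pM2l ?invr_gt0.
  by rewrite mulVf ?gt_eqF //= mulr1n; lra.
- by rewrite linear_map_axpy cu.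
Qed.

(** Two facets entered along the same direction share a point in their open cones. *)
Lemma enters_unique s u S S' : enters s u S -> enters s u S' -> S = S'.
Proof.
move=> sS sS'; have [e e0 eS] := enters_nearby sS.
have [e' e0' eS'] := enters_nearby sS'.
have [|a [Sa a0 la]] := eS (Num.min e e').
  by rewrite lt_min e0 e0' ge_min lexx.
have [|b [Sb b0 lb]] := eS' (Num.min e e').
  by rewrite lt_min e0 e0' ge_min lexx orbT.
have nneg (T : {fset pt}) (f : point R pt) : supported T f ->
    (forall x, x \in T -> 0 < f x) -> forall x, 0 <= f x.
  move=> Tf f0 x; have [/f0/ltW//|/Tf->//] := boolP (x \in T).
case: sS sS' => SY _ _ _ [SY' _ _ _].
have ab : a = b.
  apply: (cone_unique SY SY' Sa Sb); last by rewrite la lb.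
    exact: nneg a0.
  exact: nneg b0.
apply/fsetP => x; apply/idP/idP => [/a0|/b0].
  by apply: contraTT => /Sb; rewrite ab => ->; rewrite ltxx.
by apply: contraTT => /Sa; rewrite -ab => ->; rewrite ltxx.
Qed.

Definition interior (s : {fset pt}) :=
  [forall i : 'I_N, has (fun x : pt => x i != 0) s].

(** Coordinates are nonnegative, so nothing cancels in the sum. *)
Lemma vertex_sum_gt0 (s : {fset pt}) i : s \in faces Y ->
  (0 < vertex_sum_of s i) = has (fun x : pt => x i != 0) s.
Proof.
move=> sY; rewrite /vertex_sum_of (linear_map_supported _ (face_sub_vertices sY)).
  have x0 (x : pt) : x \in s -> 0 <= x i by move=> /(face_vertex sY)/vertex_ge0.
  have [/hasP[x /= xs xi]|/hasPn xi] := boolP (has _ _).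
    rewrite (big_fsetD1 x) //= xs mul1r ltr_pwDl // ?lt_def ?xi ?x0 //.
    rewrite big_seq sumr_ge0 // => y; rewrite !inE => /andP[_ ys].
    by rewrite mulr_ge0 // x0.
  rewrite big1_seq ?ltxx // => x /= xs.
  by have := xi _ xs; rewrite negbK => /eqP ->; rewrite mulr0.
by move=> x /negPf ->.
Qed.

Lemma vertex_sum_ge0 (s : {fset pt}) i : s \in faces Y -> 0 <= vertex_sum_of s i.
Proof.
move=> sY; rewrite /vertex_sum_of (linear_map_supported _ (face_sub_vertices sY)).
  rewrite big_seq sumr_ge0 // => x xs.
  apply: mulr_ge0; first exact: ler0n.
  exact: vertex_ge0 (face_vertex sY xs).
by move=> x /negPf ->.
Qed.

End SubdividedSimplex.

(** * The Euler relation for stars of faces *)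

(** Toggling an element of S outside A reverses the sign and preserves the interval
    from A to S. *)
Lemma interval_sign_sum (D : numDomainType) (K : choiceType) (A S : {fset K}) :
  (A `<=` S)%fset ->
  \sum_(s <- fpowerset S | (A `<=` s)%fset) (-1) ^+ #|` s|
    = (A == S)%:R * (-1) ^+ #|` S| :> D.
Proof.
move=> AS; rewrite big_fset_condE /=; set T := [fset s in _ | _]%fset.
have memT s : (s \in T) = (A `<=` s)%fset && (s `<=` S)%fset.
  by rewrite !inE /= fpowersetE andbC.
move: T memT => T memT; have [AeS|/eqP AneS] := eqVneq A S.
  rewrite (_ : T = [fset S]%fset) ?big_seq_fset1 ?mul1r //.
  by apply/fsetP => s; rewrite memT inE AeS eqEfsubset andbC.
have /fsubsetPn[x xS xA] : ~~ (S `<=` A)%fset.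
  by apply/negP => SA; case: AneS; apply/eqP; rewrite eqEfsubset AS.
pose f (s : {fset K}) := if x \in s then (s `\ x)%fset else (x |` s)%fset.
have fK : involutive f.
  move=> s; rewrite /f; have [xs|xs] := boolP (x \in s).
    by rewrite !inE eqxx /= fsetD1K.
  by rewrite fset1U1 fsetU1K.
have fT s : s \in T -> f s \in T.
  rewrite !memT /f => /andP[As sS]; case: ifP => xs; apply/andP; split.
  - by rewrite fsubsetD1 As.
  - exact: fsubset_trans (fsubD1set _ _) sS.
  - exact: fsubset_trans As (fsubsetU1 _ _).
  - by rewrite fsubUset fsub1set xS.
have TE : T = (f @` T)%fset.
  apply/fsetP => s; apply/idP/imfsetP => [sT|[t /= tT ->]]; last exact: fT.
  by exists (f s); rewrite ?fK //= fT.
rewrite mul0r; apply/eqP; rewrite -eqNr -sumrN; apply/eqP.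
rewrite [in RHS]TE big_imfset /=; last by move=> s t _ _; apply: inv_inj.
apply: eq_bigr => s _; rewrite /f; have [xs|xs] := boolP (x \in s).
  by rewrite (cardfsD1 x s) xs exprS mulN1r opprK.
by rewrite cardfsU1 xs exprS mulN1r.
Qed.

Section Euler.
Variables (R : realType) (m : nat).
Local Notation N := m.+1.
Local Notation pt := (point R 'I_N).
Variable Y : complex pt.
Hypothesis subdivY : is_subdivision (std_simplex m) Y.

Lemma generic_opp (q : pt) : generic Y q -> generic Y (fun i => - q i).
Proof.
move=> gq t a tY tm ta aq; apply: (gq t (fun x => -1 * a x)) => //.
  by move=> x /ta ->; rewrite mulr0.
by rewrite linear_mapZ aq; apply/funext => i; rewrite mulN1r opprK.
Qed.

Lemma sum_enters (D : nzRingType) (s : {fset pt}) (u : pt) (S : {fset pt}) :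
  enters Y s u S -> \sum_(S' <- faces Y) `[<enters Y s u S'>]%:R = 1 :> D.
Proof.
move=> sS; have [SY _ _ _] := sS.
rewrite (big_fsetD1 S) //= asboolT // big1_seq ?addr0 // => S'.
rewrite !inE => /andP[_ /andP[SS' _]]; rewrite asboolF // => sS'.
by case/eqP: SS'; exact (enters_unique subdivY sS' sS).
Qed.

(** Leaving a boundary point in direction - q, with q in the open orthant, leaves the
    simplex at once; leaving an interior point does not. *)
Lemma interior_entersN (q : pt) (s : {fset pt}) : (forall i, 0 < q i) ->
  generic Y q -> s \in faces Y ->
  interior s <-> exists S, enters Y s (fun i => - q i) S.
Proof.
move=> q0 gq sY; split=> [/forallP sint|[S sS]].
  have s0 i : 0 < vertex_sum_of Y s i by rewrite vertex_sum_gt0 // sint.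
  (* The first time at which the displacement along - q meets a wall, capped by 1. *)
  pose e := \big[Num.min/1]_i (vertex_sum_of Y s i / q i).
  have e0 : 0 < e by apply: lt_bigmin => // i _; rewrite divr_gt0.
  apply: (enters_exists subdivY sY (generic_opp gq) e0) => eps /andP[_ epse] i.
  rewrite mulrN subr_ge0 -ler_pdivlMr //; apply: le_trans epse _.
  exact: bigmin_le_cond.
apply/forallP => i; rewrite -(vertex_sum_gt0 subdivY) //.
have [e e0 /(_ e)[|a [Sa a0 la]]] := enters_nearby sS; first by rewrite e0 lexx.
have [SY _ _ _] := sS.
have : 0 <= linear_map Y a i.
  rewrite (linear_map_supported _ (face_sub_vertices SY)) // big_seq sumr_ge0 //.
  move=> x xS; rewrite mulr_ge0 ?(ltW (a0 _ xS)) //.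
  by rewrite (vertex_ge0 subdivY) // (face_vertex SY).
by rewrite la; have := mulr_gt0 e0 (q0 i); lra.
Qed.

Lemma enters_generic (q : pt) (r : {fset pt}) : (forall i, 0 < q i) ->
  generic Y q -> r \in faces Y -> exists S, enters Y r q S.
Proof.
move=> q0 gq rY; apply: (enters_exists subdivY rY gq ltr01) => eps /andP[eps0 _] i.
apply: addr_ge0; first exact: (vertex_sum_ge0 subdivY).
by rewrite mulr_ge0 // ltW.
Qed.

(** Let G be the set of vertices of S on which q has a positive coordinate.  The faces
    from which - q enters S are those in the interval from G to S, and q enters S from
    r exactly when G and r together exhaust S.  This is the degenerate case in which
    the alternating sum over the faces containing r does not vanish. *)
Lemma star_sign_sum (D : numDomainType) (q : pt) (r S : {fset pt}) :
  generic Y q -> r \in faces Y -> S \in faces Y ->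
  \sum_(s <- faces Y | (r `<=` s)%fset)
      `[<enters Y s (fun i => - q i) S>]%:R * (-1) ^+ #|` s|
    = `[<enters Y r q S>]%:R * (-1) ^+ N :> D.
Proof.
move=> gq rY SY.
have [[c [SN Sc cq]]|noc] := pselect (exists c,
    [/\ #|` S| = N, supported S c & linear_map Y c = q]); last first.
  rewrite big1 => [|s _]; last first.
    rewrite asboolF ?mul0r // => -[_ SN _ [c [Sc cq _]]]; apply: noc.
    exists (fun x => -1 * c x); split=> // [x /Sc ->|]; first by rewrite mulr0.
    by rewrite linear_mapZ cq; apply/funext => i; rewrite mulN1r opprK.
  rewrite asboolF ?mul0r // => -[_ SN _ [c [Sc cq _]]]; apply: noc.
  by exists c; split.
pose G := [fset x in S | 0 < c x]%fset.
have c0 x : x \in S -> c x != 0 by exact: (generic_coord_neq0 subdivY gq SY).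
have entN s : enters Y s (fun i => - q i) S <-> (G `<=` s)%fset && (s `<=` S)%fset.
  split=> [[_ _ sS [d [Sd dq d0]]]|/andP[Gs sS]].
    rewrite sS andbT; apply/fsubsetP => x; rewrite !inE /= => /andP[xS cx].
    apply: contraT => xs; have := d0 x xS xs.
    have -> : d = fun x => -1 * c x.
      apply: (face_coord_inj subdivY SY Sd) => [y /Sc ->|]; first by rewrite mulr0.
      by rewrite dq linear_mapZ cq; apply/funext => i; rewrite mulN1r.
    by rewrite mulN1r oppr_gt0 ltNge (ltW cx).
  split=> //; exists (fun x => -1 * c x); split=> [x /Sc ->||x xS xs].
  - by rewrite mulr0.
  - by rewrite linear_mapZ cq; apply/funext => i; rewrite mulN1r.
  rewrite mulN1r oppr_gt0 lt_neqAle c0 // leNgt; apply: contra xs => cx.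
  by apply: (fsubsetP Gs); rewrite !inE /= xS.
have entr : enters Y r q S <-> (r `<=` S)%fset && ((G `|` r)%fset == S).
  split=> [[_ _ rS [d [Sd dq d0]]]|/andP[rS /eqP GrS]].
    rewrite rS eqEfsubset fsubUset rS fset_sub /=.
    have dc : d = c by apply: (face_coord_inj subdivY SY) => //; rewrite dq.
    apply/fsubsetP => x xS; rewrite !inE /= xS /= orbC.
    have [//|xr] := boolP (x \in r); rewrite -dc d0 //.
  split=> //; exists c; split=> // x; rewrite -{1}GrS !inE.
  by case/orP => [/andP[_ ->]//|->].
rewrite (_ : `[< enters Y r q S >] = (r `<=` S)%fset && ((G `|` r)%fset == S)); last first.
  by apply/asboolP/idP => /entr.
have [rS|rS] := boolP (r `<=` S)%fset; last first.
  rewrite mul0r big1 // => s rs; rewrite asboolF ?mul0r // => -[_ _ sS _].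
  by case/negP: rS; exact: fsubset_trans sS.
have := @interval_sign_sum D _ (G `|` r)%fset S.
rewrite fsubUset rS fset_sub /= SN => /(_ isT) <-.
rewrite big_mkcond /= [RHS]big_mkcond /=.
apply/esym; rewrite -[RHS](@big_fset_incl _ _ _ _ (fpowerset S)).
- apply: eq_big_seq => s /=; rewrite fpowersetE fsubUset => sS.
  rewrite andbC; case: ifP => [/andP[-> Gs]|].
    by rewrite asboolT ?mul1r //; apply/entN; rewrite Gs.
  case: ifP => // _ /= Gs; rewrite asboolF ?mul0r // => /entN.
  by rewrite Gs.
- by apply/fsubsetP => s; rewrite fpowersetE => sS; exact: complex_down sS SY.
- move=> s _; rewrite fpowersetE => /negP sS; case: ifP => // _.
  by rewrite asboolF ?mul0r // => -[].
Qed.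

(** Euler relation for the interior faces in the star of r.  Each interior face enters
    a single facet in direction - q, so the sum can be taken facet by facet, where
    star_sign_sum leaves only the facet that q enters from r. *)
Lemma interior_star_sum (D : numDomainType) (r : {fset pt}) : r \in faces Y ->
  \sum_(s <- faces Y | interior s && (r `<=` s)%fset) (-1) ^+ #|` s|
    = (-1) ^+ N :> D.
Proof.
move=> rY; have [q q0 gq] := ex_generic Y.
transitivity (\sum_(s <- faces Y | (r `<=` s)%fset) \sum_(S <- faces Y)
    `[<enters Y s (fun i => - q i) S>]%:R * (-1) ^+ #|` s| : D).
  rewrite big_mkcondl /= [LHS]big_seq_cond [RHS]big_seq_cond.
  apply: eq_bigr => s /andP[sY _]; rewrite -big_distrl /=.
  have := interior_entersN q0 gq sY; case: ifP => [_ [/(_ isT)[S sS] _]|_ [_ sint]].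
    by rewrite (sum_enters _ sS) mul1r.
  rewrite big1 ?mul0r // => S _; rewrite asboolF // => sS.
  by have := sint (ex_intro _ S sS).
rewrite exchange_big /=.
rewrite (eq_big_seq _ (fun S => @star_sign_sum D q r S gq rY)) -big_distrl /=.
by have [S rS] := enters_generic q0 gq rY; rewrite (sum_enters _ rS) mul1r.
Qed.

End Euler.

(** * Counting the faces of a subdivided complex *)

Lemma in_fset_sep (K : choiceType) (A : {fset K}) (P : pred K) x :
  (x \in [fset y in A | P y]%fset) = (x \in A) && P x.
Proof. by rewrite !inE. Qed.

Section Support.
Variable R : realType.

Definition support (V : choiceType) (s : {fset point R V}) (v : V) : bool :=
  has (fun x : point R V => x v != 0) s.

Section Push.
Variables (I : finType) (V : choiceType) (h : I -> V).
Hypothesis h_inj : injective h.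

Lemma push_at (x : point R I) i : push h x (h i) = x i.
Proof. by rewrite /push (eq_bigl _ _ (inj_eq h_inj ^~ i)) big_pred1_eq. Qed.

Lemma push_out (x : point R I) v : (forall i, h i <> v) -> push h x v = 0.
Proof. by move=> hv; rewrite /push big1 // => i /eqP /hv. Qed.

Lemma push_inj : injective (push h : point R I -> point R V).
Proof.
move=> x y xy; apply/funext => i.
by rewrite -(push_at x) -(push_at y) xy.
Qed.

Lemma push_face_inj : injective (push_face h : {fset point R I} -> _).
Proof.
move=> s t st; apply/fsetP => x.
by rewrite -(mem_imfset imfset_key _ push_inj) -/(push_face h s) st mem_imfset //; exact: push_inj.
Qed.

Lemma card_push_face (s : {fset point R I}) : #|` push_face h s| = #|` s|.
Proof. by rewrite /push_face card_imfset //; exact: push_inj. Qed.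

Lemma support_push_face (s : {fset point R I}) v :
  support (push_face h s) v <-> exists2 i, support s i & h i = v.
Proof.
split=> [/hasP[_ /imfsetP[x /= xs ->] xv]|[i /hasP[x /= xs xi] <-]].
  have [[i hi]|nov] := pselect (exists i, h i = v).
    exists i => //; apply/hasP; exists x => //=.
    by rewrite -(push_at x) hi.
  by case/eqP: xv; apply: push_out => i hi; apply: nov; exists i.
by apply/hasP; exists (push h x); [apply/imfsetP; exists x|rewrite /= push_at].
Qed.

End Push.

Lemma push_comp (I J : finType) (V : choiceType) (g : I -> J) (h : J -> V)
    (x : point R I) : injective g -> injective h ->
  push h (push g x) = push (h \o g) x.
Proof.
move=> gi hi; apply/funext => v.
rewrite /push [RHS](partition_big g (fun j => h j == v)) //=.
apply: eq_bigr => j hj; apply: eq_bigl => i.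
by apply/idP/andP => [/eqP gj|[_ //]]; rewrite gj.
Qed.

Lemma push_face_comp (I J : finType) (V : choiceType) (g : I -> J) (h : J -> V)
    (s : {fset point R I}) : injective g -> injective h ->
  push_face h (push_face g s) = push_face (h \o g) s.
Proof.
move=> gi hi; rewrite /push_face -imfset_comp; apply: eq_imfset => //= x.
exact: push_comp.
Qed.

Lemma push_face_id (I : finType) (s : {fset point R I}) : push_face id s = s.
Proof.
rewrite /push_face -[RHS]imfset_id; apply: eq_imfset => //= x.
by apply/funext => i; rewrite /push big_pred1_eq.
Qed.

Lemma carrierE (m : nat) (Y : complex (point R 'I_m.+1)) s i :
  is_subdivision (std_simplex m) Y -> s \in faces Y ->
  (i \in carrier (std_simplex m) s) = support s i.
Proof.
move=> subdivY sY; pose T := [fset i in 'I_m.+1 | support s i]%fset.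
have sT : inside s T.
  move=> x xs; have xY := face_vertex sY xs.
  have xT v : v \notin T -> x v = 0.
    apply: contraNeq => xv; rewrite !inE /=; apply/hasP; by exists x.
  split=> // [v|]; first exact: (vertex_ge0 subdivY).
  rewrite -(vertex_coord_sum subdivY xY).
  rewrite [LHS](@big_fset_incl _ _ _ _ T [fset i | i in 'I_m.+1]%fset).
  - by rewrite big_imfset //= big_enum.
  - by apply/fsubsetP=> j _; apply/imfsetP; exists j.
  - by move=> j _ /xT.
rewrite (_ : carrier _ _ = T) ?inE //=.
have Tmin t' : inside s t' -> (T `<=` t')%fset.
  move=> st'; apply/fsubsetP => j; rewrite !inE /= => /hasP[x xs /=].
  by apply: contraNT => jt'; case: (st' _ xs) => _ ->.
have TX : T \in faces (std_simplex m).
  rewrite fpowersetE; apply/fsubsetP=> j _; apply/imfsetP; by exists j.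
apply: xget_unique => //; first by split=> // t' _; exact: Tmin.
move=> t [_ st tmin]; apply/eqP; rewrite eqEfsubset Tmin // andbT.
exact: tmin.
Qed.

End Support.

Section Method.
Variables (R : realType) (Phi : subdivision_method R).

(** The restriction axiom of a method with the permutation taken to be trivial. *)
Lemma method_push (k m : nat) (i : 'I_k.+1 -> 'I_m.+1) s : injective i ->
  s \in faces (Phi k) -> push_face i s \in faces (Phi m).
Proof.
move=> i_inj sk; have [/(_ s sk)[+ _] _] := method_restr Phi 1%g i_inj.
by rewrite (_ : (fun a => _) = i) //; apply/funext => a; rewrite perm1.
Qed.

Lemma method_pull (k m : nat) (i : 'I_k.+1 -> 'I_m.+1) s : injective i ->
  s \in faces (Phi m) -> (forall v, support s v -> exists a, i a = v) ->
  exists2 s', s' \in faces (Phi k) & s = push_face i s'.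
Proof.
move=> i_inj sm si; have [_ /(_ s sm)] := method_restr Phi 1%g i_inj.
rewrite (_ : (fun a => _) = i); last by apply/funext => a; rewrite perm1.
apply; apply/fsubsetP => v.
rewrite (carrierE _ (method_subdivision Phi m) sm) => /si[a <-].
by apply/imfsetP; exists a; rewrite //= perm1.
Qed.

(** An arbitrary labelling of a face by an initial segment of the integers replaces the
    dependent type of bijections in the definition of the subdivided complex. *)
Lemma subdivideP (V : choiceType) (X : complex V) (s : {fset point R V}) :
  s \in faces (subdivide Phi X) <-> s = fset0 \/
    exists (m : nat) (h : 'I_m.+1 -> V) (s' : {fset point R 'I_m.+1}),
    [/\ injective h, [fset h i | i in 'I_m.+1]%fset \in faces X,
        s' \in faces (Phi m) & s = push_face h s'].
Proof.
rewrite /= /subdivide_faces in_fset1U; split.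
  case/orP => [/eqP ->|sX]; first by left.
  right; move: sX.
  case/bigfcupP => t /andP[tX _] /bigfcupP[h /andP[_ /injectiveP hinj]].
  case/imfsetP=> s' /= s'Phi ->.
  have hv_inj : injective (fun i => fsval (h i)).
    by move=> i j /val_inj /hinj.
  exists #|` t|.-1, (fun i => fsval (h i)), s'; split=> //.
  rewrite (_ : [fset _ | _ in _]%fset = t) //; apply/eqP; rewrite eqEfcard.
  apply/andP; split; first by apply/fsubsetP => _ /imfsetP[i _ ->]; exact: fsvalP.
  rewrite card_imfset // -cardE card_ord prednK // cardfs_gt0.
  by apply/fset0Pn; exists (fsval (h ord0)); exact: fsvalP.
case=> [->|[m [h [s' [h_inj tX s'Phi ->]]]]]; first by rewrite eqxx.
apply/orP; right; apply/bigfcupP.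
set t := [fset h i | i in 'I_m.+1]%fset in tX *.
have tm : #|` t|.-1 = m by rewrite card_imfset //= size_enum_ord.
have [g [g_inj gt [s'' s''Phi ->]]] : exists g : 'I_(#|` t|.-1).+1 -> V,
    [/\ injective g, forall i, g i \in t
      & exists2 s'', s'' \in faces (Phi #|` t|.-1)
        & push_face h s' = push_face g s''].
  by rewrite tm; exists h; split=> // [i|]; [apply/imfsetP; exists i|exists s'].
exists t; first by rewrite tX.
apply/bigfcupP; exists [ffun i => [` gt i]%fset].
  rewrite mem_index_enum; apply/injectiveP => i j; rewrite !ffunE.
  by move/(congr1 val)/g_inj.
apply/imfsetP; exists s'' => //=; congr push_face.
by apply/funext => i; rewrite ffunE.
Qed.

(** Faces with j vertices of the subdivided simplex on i vertices that lie in no proper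
    face of it.  The case i = 0 is the empty simplex, subdivided into itself. *)
Definition interior_count (i j : nat) : nat :=
  if i is m.+1 then
    #|` [fset s in faces (Phi m) | interior s && (#|` s| == j)]%fset|
  else (j == 0)%N.

Definition has_support (V : choiceType) (s : {fset point R V}) (t : {fset V}) :=
  `[<forall v, (v \in t) = support s v>].

Lemma has_support_inj (V : choiceType) (s : {fset point R V}) t t' :
  has_support s t -> has_support s t' -> t = t'.
Proof. by move=> /asboolP st /asboolP st'; apply/fsetP => v; rewrite st st'. Qed.

(** The support of a face of the subdivision is the face of X that carries it. *)
Lemma face_supported (V : choiceType) (X : complex V) (s : {fset point R V}) :
  s \in faces (subdivide Phi X) -> exists2 t, t \in faces X & has_support s t.
Proof.
case/subdivideP => [->|[m [h [s' [h_inj tX s'Phi ->]]]]].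
  exists fset0; first exact: complex_fset0.
  by apply/asboolP => v; rewrite inE.
exists [fset h i | i in [pred i | support s' i]]%fset.
  apply: complex_down tX; apply/fsubsetP => _ /imfsetP[i _ ->].
  by apply/imfsetP; exists i.
apply/asboolP => v; apply/imfsetP/idP => [[i /= si ->]|].
  by apply/support_push_face => //; exists i.
by move/(support_push_face h_inj) => [i si <-]; exists i.
Qed.

Lemma support0 (V : choiceType) (X : complex V) (s : {fset point R V}) :
  s \in faces (subdivide Phi X) -> has_support s fset0 = (s == fset0).
Proof.
move=> sX; apply/asboolP/eqP => [s0|-> v]; last by rewrite inE.
case/subdivideP: sX s0 => [//|[m [h [s' [h_inj tX s'Phi ->]]]]] s0.
suff -> : s' = fset0 by rewrite /push_face imfset0.
apply/eqP/negPn/negP => /fset0Pn[x xs'].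
have : \sum_i x i != 0.
  rewrite (vertex_coord_sum (method_subdivision Phi m)) ?oner_eq0 //.
  exact: face_vertex xs'.
rewrite big1 ?eqxx // => i _; apply/eqP/negPn/negP => xi.
have := s0 (h i); rewrite inE => /esym/negP; apply.
by apply/(support_push_face h_inj); exists i => //; apply/hasP; exists x.
Qed.

Lemma ex_labelling (V : choiceType) (t : {fset V}) m : #|` t| = m.+1 ->
  exists2 h : 'I_m.+1 -> V, injective h & [fset h i | i in 'I_m.+1]%fset = t.
Proof.
move=> tm; have : t != fset0 by rewrite -cardfs_gt0 tm.
case/fset0Pn => x0 _; exists (fun i : 'I_m.+1 => nth x0 t i).
  move=> i j /eqP; rewrite nth_uniq ?fset_uniq ?tm //.
  by move=> /eqP; exact: val_inj.
apply/fsetP => v; apply/imfsetP/idP => [[i _ ->]|vt].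
  by apply: mem_nth; rewrite tm.
have it : (index v t < m.+1)%N by rewrite -tm index_mem.
by exists (Ordinal it); rewrite //= nth_index.
Qed.

(** The faces carried by t are those of the model simplex, transported along a labelling
    of t.  Another face t' of X yields no further ones, since the method on t' restricts
    to the method on t. *)
Lemma card_supported (V : choiceType) (X : complex V) t j : t \in faces X ->
  #|` [fset s in faces (subdivide Phi X) | (#|` s| == j) && has_support s t]%fset|
  = interior_count #|` t| j.
Proof.
move=> tX; case tE: #|` t| => [|m].
  rewrite (cardfs0_eq tE) /=.
  rewrite (_ : [fset s in _ | _]%fset = if j == 0%N then [fset fset0]%fset else fset0).
    by case: ifP => _; rewrite ?cardfs1 ?cardfs0.
  apply/fsetP => s; rewrite in_fset_sep; apply/andP/idP => [[sX]|].
    rewrite (@support0 _ X s sX) => /andP[+ /eqP s0]; rewrite s0 cardfs0 => /eqP <-.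
    by rewrite /= inE.
  case: eqP => // j0; rewrite inE => /eqP ->; split; last first.
    by rewrite cardfs0 j0 eqxx (support0 (X := X)) //; apply/subdivideP; left.
  by apply/subdivideP; left.
have [h h_inj ht] := ex_labelling tE.
rewrite /=; set T := [fset s in faces (Phi m) | _]%fset.
have <- : #|` [fset push_face h s' | s' in T]%fset| = #|` T|.
  by rewrite card_imfset //; exact: push_face_inj.
congr (#|` _|); apply/fsetP => s; apply/idP/imfsetP; last first.
  case=> s'; rewrite /= in_fset_sep => /andP[s'Phi /andP[/forallP s'int s'j]] ->.
  rewrite in_fset_sep; apply/andP; split; first by apply/subdivideP; right; exists m, h, s'; rewrite ht.
  rewrite card_push_face // s'j /=; apply/asboolP => v; rewrite -ht.
  apply/imfsetP/idP => [[i _ ->]|/(support_push_face h_inj)[i _ <-]].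
    by apply/(support_push_face h_inj); exists i => //; exact: s'int.
  by exists i.
rewrite in_fset_sep => /andP[sX /andP[sj /asboolP st]].
case/(subdivideP X): sX st sj => [->|[m' [h' [s' [h'_inj t'X s'Phi ->]]]]] st sj.
  have : t != fset0 by rewrite -cardfs_gt0 tE.
  by case/fset0Pn => v; rewrite st.
have pre a : exists i, support s' i /\ h' i = h a.
  have : h a \in t by rewrite -ht; apply/imfsetP; exists a.
  by rewrite st => /(support_push_face h'_inj)[i si hi]; exists i.
have [g Hg] := choice pre.
have g_inj : injective g.
  by move=> a b gab; apply: h_inj; rewrite -(Hg a).2 -(Hg b).2 gab.
have [s'' s''Phi s'E] : exists2 s'', s'' \in faces (Phi m) & s' = push_face g s''.
  apply: method_pull => // v sv.
  have : h' v \in t by rewrite st; apply/(support_push_face h'_inj); exists v.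
  rewrite -ht => /imfsetP[a _ hv]; exists a; apply: h'_inj.
  by rewrite (Hg a).2.
have E : push_face h' s' = push_face h s''.
  rewrite s'E push_face_comp //; congr push_face.
  by apply/funext => a; exact: (Hg a).2.
exists s'' => //=; rewrite in_fset_sep s''Phi -(card_push_face h_inj) -E sj andbT /=.
apply/forallP => a; have : h a \in t by rewrite -ht; apply/imfsetP; exists a.
by rewrite st E => /(support_push_face h_inj)[b sb /h_inj <-].
Qed.

Lemma sum_faces_card (V : choiceType) (X : complex V) (F : nat -> nat) d :
  (dimS X <= d)%N ->
  (\sum_(t <- faces X) F #|` t| = \sum_(i < d.+1) fnum X i * F i)%N.
Proof.
move=> Xd; have td t : t \in faces X -> (#|` t| < d.+1)%N.
  move=> tX; rewrite ltnS; apply: leq_trans Xd.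
  by rewrite /dimS; apply: (@leq_bigmax_seq _ _ _ (fun t : {fset V} => #|` t|)).
transitivity (\sum_(t <- faces X) \sum_(i < d.+1) (#|` t| == i) * F i)%N.
  apply: eq_big_seq => t /td tlt.
  rewrite (bigD1 (Ordinal tlt)) //= eqxx mul1n big1 ?addn0 // => i ine.
  by case: eqP => // ti; case/eqP: ine; apply: val_inj.
rewrite exchange_big; apply: eq_bigr => i _ /=; rewrite -big_distrl /=.
congr (_ * _)%N; rewrite /fnum card_fset_sum1.
by rewrite -big_fset_condE /= [RHS]big_mkcond /=; apply: eq_bigr => t _; case: eqP.
Qed.

(** Subdividing acts linearly on face numbers: each face of the subdivision is counted
    with the face of X that carries it. *)
Lemma fnum_subdivide (V : choiceType) (X : complex V) d j : (dimS X <= d)%N ->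
  (fnum (subdivide Phi X) j = \sum_(i < d.+1) fnum X i * interior_count i j)%N.
Proof.
move=> Xd; rewrite -(sum_faces_card (interior_count ^~ j) Xd).
transitivity (\sum_(s <- [fset s in faces (subdivide Phi X) | #|` s| == j]%fset)
    \sum_(t <- faces X) has_support s t)%N.
  rewrite /fnum card_fset_sum1; apply: eq_big_seq => s.
  rewrite in_fset_sep => /andP[/face_supported[t tX st] _].
  rewrite (big_fsetD1 t) //= st big1_seq ?addn0 // => t'.
  rewrite !inE => /andP[_ /andP[tt' _]]; apply/eqP; rewrite eqb0.
  by apply: contra tt' => st'; apply/eqP; exact: has_support_inj st' st.
rewrite exchange_big /=; apply: eq_big_seq => t tX; rewrite -(card_supported j tX).
rewrite card_fset_sum1 -!big_fset_condE /= big_mkcond [RHS]big_mkcond /=.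
by apply: eq_bigr => s _; case: eqP => //= _; case: has_support.
Qed.

Lemma subdivide_std (m : nat) j :
  fnum (subdivide Phi (std_simplex m)) j = fnum (Phi m) j.
Proof.
rewrite /fnum; congr (#|` _|); apply/fsetP => s; rewrite !in_fset_sep; congr (_ && _).
apply/idP/idP => [/subdivideP[->|[k [h [s' [h_inj _ s'Phi ->]]]]]|sPhi].
- exact: complex_fset0.
- exact: method_push.
apply/subdivideP; right; exists m, id, s; split=> //; last by rewrite push_face_id.
by rewrite fpowersetE; apply/fsubsetP => i _; apply/imfsetP; exists i.
Qed.

Lemma dimS_std m : dimS (std_simplex m) = m.+1.
Proof.
have cardT : #|` [fset i | i in 'I_m.+1]%fset| = m.+1.
  by rewrite card_imfset //= size_enum_ord.
apply/eqP; rewrite eqn_leq; apply/andP; split.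
  apply/bigmax_leqP_seq => t; rewrite fpowersetE => /fsubset_leq_card.
  by rewrite cardT.
have : [fset i | i in 'I_m.+1]%fset \in faces (std_simplex m).
  by rewrite fpowersetE fsubset_refl.
move=> /(@leq_bigmax_seq _ _ xpredT (fun t : {fset 'I_m.+1} => #|` t|))/(_ isT).
by rewrite cardT.
Qed.

End Method.

(** * Facets and ridges of a subdivided simplex *)

Section Facets.
Variables (R : realType) (m : nat).
Local Notation N := m.+1.
Local Notation pt := (point R 'I_N).
Variable Y : complex pt.
Hypothesis subdivY : is_subdivision (std_simplex m) Y.

Lemma face_in_facet (s : {fset pt}) : s \in faces Y ->
  exists S, [/\ S \in faces Y, #|` S| = N & (s `<=` S)%fset].
Proof.
move=> sY; have [q q0 gq] := ex_generic Y.
by have [S [SY SN sS _]] := enters_generic subdivY q0 gq sY; exists S.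
Qed.

(** A generic vector of the open orthant enters some facet from S, which must be S; hence
    it is a combination of the vertices of S, and no coordinate vanishes on all of them. *)
Lemma facet_interior (S : {fset pt}) : S \in faces Y -> #|` S| = N -> interior S.
Proof.
move=> SY SN; have [q q0 gq] := ex_generic Y.
have [S' [S'Y S'N SS' [c [S'c cq _]]]] := enters_generic subdivY q0 gq SY.
have {SS'}SE : S = S' by apply/eqP; rewrite eqEfcard SS' S'N SN /=.
rewrite -{S' S'Y S'N}SE in S'c.
apply/forallP => i; apply/negPn/negP => /hasPn Si.
have := q0 i; rewrite -cq (linear_map_supported _ (face_sub_vertices SY)) //.
rewrite big1_seq ?ltxx // => x /= /Si; rewrite negbK => /eqP ->.
by rewrite mulr0.
Qed.

Definition facets := [fset S in faces Y | #|` S| == N]%fset.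

Definition ridges i := [fset t in faces Y | (#|` t| == m) && ~~ support t i]%fset.

(** Two distinct ridges of S together contain all its vertices, which would then lie in
    the i-th wall. *)
Lemma ridge_unique (S t t' : {fset pt}) i : S \in facets -> t \in ridges i ->
  t' \in ridges i -> (t `<=` S)%fset -> (t' `<=` S)%fset -> t = t'.
Proof.
rewrite /facets /ridges !in_fset_sep.
move=> /andP[SY /eqP SN] /andP[_ /andP[/eqP tm ti]].
move=> /andP[_ /andP[/eqP tm' ti']] tS tS'.
apply/eqP; apply: contraT => tt'.
have := facet_interior SY SN => /forallP/(_ i)/hasP[x xS xi].
have ttS : (t `|` t')%fset = S.
  apply/eqP; rewrite eqEfcard fsubUset tS tS' SN /=.
  rewrite ltnNge; apply/negP => le_m.
  have E : t = (t `|` t')%fset by apply/eqP; rewrite eqEfcard fsubsetUl tm.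
  have E' : t' = (t `|` t')%fset by apply/eqP; rewrite eqEfcard fsubsetUr tm'.
  by case/eqP: tt'; rewrite [LHS]E [RHS]E'.
move: xS; rewrite -ttS inE => /orP[xt|xt].
  by case/negP: ti; apply/hasP; exists x.
by case/negP: ti'; apply/hasP; exists x.
Qed.

(** A facet containing a given ridge exists by purity, and within one wall it
    determines the ridge. *)
Lemma ridges_facets i : exists2 F : {fset pt} -> {fset pt},
  {in ridges i &, injective F} & forall t, t \in ridges i ->
    F t \in facets /\ (t `<=` F t)%fset.
Proof.
have pre t : exists S, t \in ridges i -> S \in facets /\ (t `<=` S)%fset.
  have [|] := boolP (t \in ridges i); last by exists fset0.
  rewrite in_fset_sep => /andP[tY _]; have [S [SY SN tS]] := face_in_facet tY.
  by exists S => _; rewrite in_fset_sep SY SN eqxx.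
have [F HF] := choice pre; exists F => // t t' tr tr' FF.
have [Ft tF] := HF _ tr; have [_ tF'] := HF _ tr'.
by apply: (ridge_unique Ft tr tr' tF); rewrite FF.
Qed.

Lemma leq_ridges_facets i : (#|` ridges i| <= #|` facets|)%N.
Proof.
have [F F_inj HF] := ridges_facets i.
have <- : #|` [fset F t | t in ridges i]%fset| = #|` ridges i|.
  by rewrite card_in_imfset.
by apply/fsubset_leq_card/fsubsetP => _ /imfsetP[t /= /HF[Ft _] ->].
Qed.

Lemma ridges_facets_eq i S : #|` ridges i| = #|` facets| -> S \in facets ->
  exists2 t, t \in ridges i & (t `<=` S)%fset.
Proof.
have [F F_inj HF] := ridges_facets i => E SF.
have : [fset F t | t in ridges i]%fset = facets.
  apply/eqP; rewrite eqEfcard -E (_ : #|` _| = #|` ridges i|); last by rewrite card_in_imfset.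
  by rewrite leqnn andbT; apply/fsubsetP => _ /imfsetP[t /= /HF[Ft _] ->].
move/fsetP/(_ S); rewrite SF => /imfsetP[t /= tr ->].
by exists t => //; case: (HF _ tr).
Qed.

(** In the case of equality every facet S has a ridge in each wall, hence a single vertex
    off each wall.  As there are as many walls as vertices of S, these vertices are the
    corners of the simplex; S is then the whole simplex and contains every face. *)
Lemma diracs_of_equality (s : {fset pt}) x :
  (forall i, #|` ridges i| = #|` facets|) -> s \in faces Y -> x \in s ->
  exists i, x = dirac_point R i.
Proof.
move=> E sY xs.
have [S [SY SN _]] := face_in_facet (complex_fset0 Y).
have SF : S \in facets by rewrite in_fset_sep SY SN eqxx.
have pre i : exists v, [/\ v \in S, v i != 0 & forall y, y \in S -> y i != 0 -> y = v].
  have [t] := ridges_facets_eq (E i) SF.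
  rewrite in_fset_sep => /andP[_ /andP[/eqP tm ti]] tS.
  have tE y : y \in S -> y i != 0 -> y \notin t.
    by move=> yS yi; apply: contra ti => yt; apply/hasP; exists y.
  have := facet_interior SY SN => /forallP/(_ i)/hasP[v vS vi].
  exists v; split=> // y yS yi; apply/eqP; apply: contraT => yv.
  have /fsubset_leq_card : ([fset y; v] `|` t `<=` S)%fset.
    by rewrite !fsubUset !fsub1set yS vS.
  rewrite -fsetUA !cardfsU1 tm SN !inE (negPf yv) (negPf (tE _ yS yi)).
  by rewrite (negPf (tE _ vS vi)) /= add1n add1n ltnn.
have [v Hv] := choice pre.
have v_surj y : y \in S -> exists i, y = v i.
  move=> yS; apply: contrapT => /forallNP nov.
  have := vertex_coord_sum subdivY (face_vertex SY yS); rewrite big1 => [/esym/eqP|i _].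
    by rewrite oner_eq0.
  by apply/eqP/negPn/negP => yi; apply: (nov i); case: (Hv i) => _ _; apply.
pose I := [fset i | i in 'I_N]%fset.
have inI i : i \in I by apply/imfsetP; exists i.
have vS : [fset v i | i in I]%fset = S.
  apply/fsetP => y; apply/imfsetP/idP => [[i _ ->]|/v_surj[i ->]]; first by case: (Hv i).
  by exists i.
have v_inj : injective v.
  have /card_in_imfsetP vi : #|` [fset v i | i in I]%fset| == #|` I|.
    by rewrite vS SN card_imfset //= size_enum_ord.
  by move=> i j; exact: vi.
have v_off i j : j != i -> v i j = 0.
  move=> ij; apply/eqP/negPn/negP => vij; case/eqP: ij; apply: v_inj.
  by case: (Hv j) => _ _ Hj; rewrite -(Hj (v i)) //; case: (Hv i).
have v_dirac i : v i = dirac_point R i.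
  apply/funext => j; rewrite /dirac_point; have [->|/v_off//] := eqVneq j i.
  have viS : v i \in S by case: (Hv i).
  rewrite -(vertex_coord_sum subdivY (face_vertex SY viS)) (bigD1 i) //= big1 ?addr0 //.
  by move=> k; exact: v_off.
suff /v_surj[i ->] : x \in S by exists i.
pose y := vertex_sum_of Y s.
pose a z := if [pick i | v i == z] is Some i then y i else 0.
have aE i : a (v i) = y i.
  by rewrite /a; case: pickP => [j /eqP/v_inj -> //|/(_ i)]; rewrite eqxx.
have y0 i : 0 <= y i by exact: (vertex_sum_ge0 subdivY).
have Sa : supported S a.
  by move=> z zS; rewrite /a; case: pickP => // i /eqP zE; case/negP: zS; rewrite -zE; case: (Hv i).
have /funeqP/(_ x) : (fun z => (z \in s)%:R) = a.
  apply: (cone_unique subdivY sY SY _ Sa) => //.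
  - by move=> z /negPf ->.
  - by move=> z; rewrite /a; case: pickP.
  apply/funext => k; rewrite [RHS](linear_map_supported _ (face_sub_vertices SY)) //.
  apply/esym; transitivity (\sum_(z <- [fset v i | i in I]%fset) a z * z k).
    by rewrite vS.
  rewrite big_imfset /=; last by move=> i j _ _; exact: v_inj.
  rewrite (big_fsetD1 k) //= aE v_dirac /dirac_point eqxx mulr1 big1_seq ?addr0 //.
  move=> i; rewrite !inE => /andP[_ /andP[ik _]].
  by rewrite v_off ?mulr0 // eq_sym.
rewrite xs; apply: contraPT => /Sa ->; apply/eqP; exact: oner_neq0.
Qed.

End Facets.

(** * The matrix of interior face counts *)

Section CountMatrix.
Variables (R : realType) (Phi : subdivision_method R).
Local Notation count := (interior_count Phi).

Lemma interior_count_gt i j : (i < j)%N -> count i j = 0%N.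
Proof.
case: i => [|m] ij /=; first by rewrite gtn_eqF.
apply/eqP; rewrite cardfs_eq0 -fsubset0; apply/fsubsetP => s.
rewrite in_fset_sep => /andP[sPhi /andP[_ /eqP sj]].
by have := leq_card_face (method_subdivision Phi m) sPhi; rewrite sj leqNgt ij.
Qed.

Lemma interior_count_facets m : count m.+1 m.+1 = #|` facets (Phi m)|.
Proof.
congr (#|` _|); apply/fsetP => s; rewrite !in_fset_sep.
case: (boolP (s \in _)) => //= sPhi; case: eqP => [sN|]; rewrite ?andbF ?andbT //.
exact: (facet_interior (method_subdivision Phi m)).
Qed.

(** The method on the simplex restricts to the method on its i-th wall. *)
Lemma interior_count_ridges m i : count m m = #|` ridges (Phi m) i|.
Proof.
case: m i => [|m] i.
  rewrite /= (_ : ridges _ _ = [fset fset0]%fset) ?cardfs1 //.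
  apply/fsetP => s; rewrite in_fset_sep inE cardfs_eq0.
  apply/andP/eqP => [[_ /andP[/eqP //]]|->]; split; first exact: complex_fset0.
  by rewrite eqxx.
have li : injective (lift i) := @lift_inj _ i.
rewrite interior_count_facets.
have <- : #|` [fset push_face (lift i) s | s in facets (Phi m)]%fset| = #|` facets (Phi m)|.
  by rewrite card_imfset //; exact: push_face_inj.
congr (#|` _|); apply/fsetP => s; rewrite in_fset_sep; apply/imfsetP/andP.
  case=> s' /=; rewrite in_fset_sep => /andP[s'Phi s'm] ->; split.
    exact: method_push.
  rewrite card_push_face // s'm /=; apply/negP.
  by move/(support_push_face li) => [j _ /eqP]; rewrite eq_sym (negPf (neq_lift _ _)).
case=> sPhi /andP[sm si].
have [//|//|v sv|s' s'Phi sE] := @method_pull _ Phi m m.+1 (lift i) s.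
  have [j ->|vi] := unliftP i v; first by exists j.
  by move: sv; rewrite vi (negPf si).
by exists s' => //=; rewrite in_fset_sep s'Phi -(card_push_face li) -sE.
Qed.

Lemma leq_diag_count m : (count m m <= count m.+1 m.+1)%N.
Proof.
rewrite (interior_count_ridges ord_max) interior_count_facets.
exact: leq_ridges_facets (method_subdivision Phi m) _.
Qed.

(** In the case of equality all vertices of the subdivided n-simplex are corners, and by
    restriction the same holds in every dimension k <= n. *)
Lemma nontrivial_diag_count n : nontrivial_method Phi n ->
  (count n n < count n.+1 n.+1)%N.
Proof.
move=> [k kn nontriv]; rewrite ltn_neqAle leq_diag_count andbT.
apply/eqP => E; apply: nontriv => s sPhi.
have diracs t x := @diracs_of_equality _ _ _ (method_subdivision Phi n) t x.
have diracn t x : t \in faces (Phi n) -> x \in t -> exists i, x = dirac_point R i.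
  by apply: diracs => i; rewrite -interior_count_ridges -interior_count_facets.
have kn1 : (k.+1 <= n.+1)%N by [].
pose h := widen_ord kn1.
have h_inj : injective h by move=> i j /(congr1 val) /= /val_inj.
have diracs_k x : x \in s -> exists i, x = dirac_point R i.
  move=> xs; have [j] : exists j, push h x = dirac_point R j.
    apply: (diracn (push_face h s)); first exact: method_push.
    by apply/imfsetP; exists x.
  move=> xj; have xE i : x i = (h i == j)%:R by rewrite -(push_at h_inj) xj.
  have [l] : exists l, h l = j.
    apply: contrapT => /forallNP nh.
    have := vertex_coord_sum (method_subdivision Phi k) (face_vertex sPhi xs).
    rewrite big1 => [/esym/eqP|i _]; first by rewrite oner_eq0.
    by rewrite xE; case: eqP => // /nh.
  move=> hl; exists l; apply/funext => i.
  by rewrite xE -hl (inj_eq h_inj).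
apply/fsetP => x; apply/idP/imfsetP => [xs|[a /=]].
  have [a xa] := diracs_k _ xs; exists a => //=.
  rewrite (carrierE _ (method_subdivision Phi k)) //; apply/hasP; exists x => //.
  by rewrite xa /dirac_point eqxx oner_neq0.
rewrite (carrierE _ (method_subdivision Phi k)) // => /hasP[y ys /= ya] ->.
have [b yb] := diracs_k _ ys; move: ya; rewrite yb {1}/dirac_point.
by have [->|] := eqVneq a b; rewrite ?eqxx // -yb.
Qed.

Lemma diag_count_mono i j : (i <= j)%N -> (count i i <= count j j)%N.
Proof.
move=> /subnKC <-; elim: (j - i)%N => [|k IH]; first by rewrite addn0.
by rewrite addnS (leq_trans IH) // leq_diag_count.
Qed.

Lemma diag_count_lt n i : nontrivial_method Phi n -> (i <= n)%N ->
  (count i i < count n.+1 n.+1)%N.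
Proof.
move=> nontriv i_n; apply: leq_ltn_trans (diag_count_mono i_n) _.
exact: nontrivial_diag_count.
Qed.

Lemma card_fpowerset_draws (K : choiceType) (S : {fset K}) k :
  #|` [fset t in fpowerset S | #|` t| == k]%fset| = 'C(#|` S|, k).
Proof.
rewrite [in RHS]cardfE -card_draws.
pose f (A : {set S}) : {fset K} := [fsetval x in A]%fset.
have fK : injective f by exact: can_inj (@FSetK _ S).
transitivity #|` [fset f A | A in [pred A : {set S} | #|A| == k]]%fset|.
  congr (#|` _|); apply/fsetP => t; rewrite in_fset_sep fpowersetE.
  apply/andP/imfsetP => [[tS tk]|[A /=]].
    exists (fsub S t); last by rewrite /f fsubK.
    by rewrite -(card_fsub tS) in tk.
  move=> Ak ->; have fAS : (f A `<=` S)%fset.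
    by apply/fsubsetP => x /imfsetP[y _ ->]; exact: fsvalP.
  by split; rewrite // -(card_fsub fAS) FSetK.
rewrite card_imfset //= -cardE; apply: eq_card => A.
by rewrite !inE.
Qed.

(** Faces of the subdivided simplex, grouped by the face of the simplex that carries them. *)
Lemma fnum_method m d j : (m < d)%N ->
  fnum (Phi m) j = (\sum_(k < d.+1) 'C(m.+1, k) * count k j)%N.
Proof.
move=> md; rewrite -subdivide_std (fnum_subdivide _ (d := d)) ?dimS_std //.
apply: eq_bigr => k _; congr (_ * _)%N.
rewrite /fnum card_fpowerset_draws; congr ('C(_, _)).
by rewrite card_imfset //= size_enum_ord.
Qed.

(** The matrix of entries (-1) ^ j * 'C(j, i) commutes with the matrix of interior counts.
    With j the number of vertices of the simplex, both sides count pairs formed by a face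
    r with i vertices and an interior face s containing it, with sign (-1) ^ |s|; on the
    right the sum over s is evaluated by the Euler relation. *)
Lemma count_involution (D : numDomainType) (j i d : nat) : (j <= d)%N ->
  \sum_(k < d.+1) (count j k)%:R * ((-1) ^+ k * 'C(k, i)%:R)
  = (-1) ^+ j * (\sum_(k < d.+1) 'C(j, k) * count k i)%:R :> D.
Proof.
case: j => [|m] md.
  rewrite !big_ord_recl /= big1 => [|k _]; last by rewrite mul0r.
  rewrite big1 => [|k _]; last by rewrite bin0n.
  by rewrite !expr0 !mul1r addr0 addn0 bin0 mul1n bin0n.
rewrite -fnum_method //.
transitivity (\sum_(s <- faces (Phi m) | interior s) (-1) ^+ #|` s| * 'C(#|` s|, i)%:R : D).
  transitivity (\sum_(s <- faces (Phi m) | interior s) \sum_(k < d.+1)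
      (#|` s| == k)%:R * ((-1) ^+ k * 'C(k, i)%:R) : D).
    rewrite exchange_big; apply: eq_bigr => k _ /=; rewrite -big_distrl /=.
    congr (_ * _); rewrite card_fset_sum1 -big_fset_condE natr_sum /=.
    rewrite big_mkcondr /=; apply: eq_bigr => s _; by case: eqP.
  rewrite big_seq_cond [RHS]big_seq_cond; apply: eq_bigr => s /andP[sPhi _].
  have sd : (#|` s| < d.+1)%N.
    have := leq_card_face (method_subdivision Phi m) sPhi.
    by rewrite ltnS => /leq_trans; apply.
  rewrite (bigD1 (Ordinal sd)) //= eqxx mul1r big1 ?addr0 // => k ks.
  case: eqP => [sk|]; last by rewrite mul0r.
  by case/eqP: ks; apply: val_inj.
transitivity (\sum_(s <- faces (Phi m) | interior s)
    \sum_(r <- faces (Phi m) | (#|` r| == i) && (r `<=` s)%fset) (-1) ^+ #|` s| : D).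
  rewrite big_seq_cond [RHS]big_seq_cond; apply: eq_bigr => s /andP[sPhi _].
  rewrite big_fset_condE /= big_const_seq count_predT iter_addr_0 mulr_natr.
  congr (_ *+ _); rewrite -card_fpowerset_draws; congr (#|` _|).
  apply/fsetP => r; rewrite !in_fset_sep fpowersetE.
  apply/andP/andP => [[rs ri]|[_ /andP[ri rs]]]; split=> //; last exact/andP.
  exact: complex_down sPhi.
transitivity (\sum_(r <- faces (Phi m) | #|` r| == i)
    \sum_(s <- faces (Phi m) | interior s && (r `<=` s)%fset) (-1) ^+ #|` s| : D).
  rewrite (exchange_big_dep (fun r => #|` r| == i)) /=; last by move=> ? ? _ /andP[].
  by apply: eq_bigr => r ri; apply: eq_bigl => s; rewrite ri.
transitivity (\sum_(r <- faces (Phi m) | #|` r| == i) (-1) ^+ m.+1 : D).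
  apply: eq_fbigr => r rPhi _.
  exact (interior_star_sum (method_subdivision Phi m) D rPhi).
rewrite big_fset_condE /= big_const_seq count_predT iter_addr_0 mulr_natr.
by [].
Qed.

End CountMatrix.

(** * Powers of a triangular matrix *)

Lemma cvg_sumr (K : numFieldType) (I : Type) (r : seq I) (P : pred I)
    (f : I -> nat -> K) (l : I -> K) :
  (forall i, P i -> f i @ \oo --> l i) ->
  (fun k => \sum_(i <- r | P i) f i k) @ \oo --> \sum_(i <- r | P i) l i.
Proof. by move=> fl; apply: cvg_big fl; exact: add_continuous. Qed.

Section PowerIteration.
Variables (R : realType) (d : nat) (L : nat -> nat -> nat).
Hypothesis L_trig : forall i j, (i < j)%N -> L i j = 0%N.
Hypothesis L_diag : forall i, (i < d)%N -> (L i i < L d d)%N.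
Local Notation lam := ((L d d)%:R : R).

(** After the perturbation has become small, the distance to 0 is contracted up to a
    small constant. *)
Lemma contraction_cvg0 (e delta : nat -> R) rho : 0 <= rho < 1 ->
  (forall k, e k.+1 = rho * e k + delta k) ->
  delta @ \oo --> 0 -> e @ \oo --> 0.
Proof.
move=> /andP[rho0 rho1] e_rec delta0; apply/cvgrPdist_le => /= eps eps0.
have r1 : 0 < 1 - rho by rewrite subr_gt0.
have [M _ HM] : \forall k \near \oo, `|delta k| <= eps / 2 * (1 - rho).
  have /cvgrPdist_le/(_ (eps / 2 * (1 - rho))) := delta0.
  have pos : 0 < eps / 2 * (1 - rho) by rewrite mulr_gt0 // divr_gt0.
  move=> /(_ pos); apply: filterS => k /=; by rewrite sub0r normrN.
have bound n : `|e (M + n)%N| <= rho ^+ n * `|e M| + eps / 2.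
  elim: n => [|n IH]; first by rewrite addn0 expr0 mul1r lerDl divr_ge0 ?ltW.
  rewrite addnS e_rec; apply: le_trans (ler_normD _ _) _.
  have dM := HM (M + n)%N (leq_addr _ _).
  rewrite normrM (ger0_norm rho0) exprS -mulrA.
  have := ler_wpM2l rho0 IH; rewrite mulrDr.
  by move: dM => /=; lra.
have /cvgrPdist_le/(_ (eps / 2)) : (fun n => rho ^+ n * `|e M|) @ \oo --> 0.
  rewrite -[X in _ --> X](mul0r `|e M|); apply: cvgMl.
  by apply: cvg_expr; rewrite ger0_norm.
have e2 : 0 < eps / 2 by rewrite divr_gt0.
move=> /(_ e2)[M' _ HM']; exists (M + M')%N => // k /= kM.
have := bound (k - M)%N; rewrite subnKC; last exact: leq_trans (leq_addr _ _) kM.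
have := HM' (k - M)%N; rewrite /= sub0r normrN leq_subRL; last exact: leq_trans (leq_addr _ _) kM.
move=> /(_ kM) h1 h2; rewrite sub0r normrN.
have := ler_norm (rho ^+ (k - M) * `|e M|); lra.
Qed.

Definition eigenrow (v : nat -> R) := forall j, (j <= d)%N ->
  \sum_(i < d.+1) v i * (L i j)%:R = lam * v j.

Lemma triangular_sum (v : nat -> R) j : (j <= d)%N ->
  \sum_(i < d.+1) v i * (L i j)%:R
  = v j * (L j j)%:R + \sum_(i < d.+1 | (j < i)%N) v i * (L i j)%:R.
Proof.
move=> jd; have jd' : (j < d.+1)%N by [].
rewrite (bigD1 (Ordinal jd')) //=; congr (_ + _).
rewrite big_mkcond [RHS]big_mkcond; apply: eq_bigr => i _ /=.
rewrite -val_eqE /=; case: ltngtP => // ij.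
by rewrite L_trig // mulr0.
Qed.

(** Back substitution from the last coordinate; the pivots lam - L j j are positive. *)
Lemma ex_eigenrow : exists2 v : nat -> R, eigenrow v & v d = 1.
Proof.
suff /(_ d) [v vd v_eig] : forall n, exists2 v : nat -> R, v d = 1 &
    forall j, (d - n <= j <= d)%N ->
      \sum_(i < d.+1) v i * (L i j)%:R = lam * v j.
  by exists v => // j jd; apply: v_eig; rewrite subnn.
elim=> [|n [v vd v_eig]].
  exists (fun i => (i == d)%:R); rewrite ?eqxx // => j; rewrite subn0 -eqn_leq => /eqP <-.
  apply: etrans (triangular_sum (fun i => (i == d)%:R) (leqnn d)) _; rewrite eqxx mul1r mulr1 big1 ?addr0 // => i.
  by move=> di; rewrite gtn_eqF // mul0r.
have [nd|nd] := leqP d n.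
  by exists v => // j /andP[_ jd]; apply: v_eig; rewrite jd (eqP (_ : d - n == 0)%N) // subn_eq0.
pose j := (d - n.+1)%N.
have jd : (j < d)%N by rewrite /j; lia.
(* The new coordinate solves the j-th equation, which involves no lower one. *)
pose vj := (\sum_(i < d.+1 | (j < i)%N) v i * (L i j)%:R) / (lam - (L j j)%:R).
exists (fun i => if i == j then vj else v i) => [|l /andP[jl ld]].
  by rewrite gtn_eqF.
have upd : \sum_(i < d.+1 | (l < i)%N) (if i == j :> nat then vj else v i) * (L i l)%:R
   = \sum_(i < d.+1 | (l < i)%N) v i * (L i l)%:R.
  by apply: eq_bigr => i li; rewrite gtn_eqF // (leq_ltn_trans _ li).
apply: etrans (triangular_sum (fun i => if i == j then vj else v i) ld) _; rewrite upd /=; have [->|lj] := eqVneq l j.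
  rewrite /vj; have := L_diag jd; rewrite -(ltr_nat R) => Lj.
  by field; rewrite subr_eq0 gt_eqF.
rewrite -triangular_sum //; apply: v_eig; rewrite ld andbT.
by move: lj jl; rewrite /j; lia.
Qed.

(** The same back substitution, applied to the difference. *)
Lemma eigenrow_unique (v w : nat -> R) : eigenrow v -> eigenrow w ->
  v d = w d -> forall j, (j <= d)%N -> v j = w j.
Proof.
move=> v_eig w_eig vwd.
suff H n j : (d - j < n)%N -> (j <= d)%N -> v j = w j by move=> j; exact: H.
elim: n j => // n IH j djn jd.
have [->//|jd'] := eqVneq j d; have {}jd' : (j < d)%N by rewrite ltn_neqAle jd'.
have := v_eig j jd; have := w_eig j jd; rewrite !triangular_sum //.
have -> : \sum_(i < d.+1 | (j < i)%N) v i * (L i j)%:R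
        = \sum_(i < d.+1 | (j < i)%N) w i * (L i j)%:R.
  apply: eq_bigr => i ji; rewrite IH //; last by rewrite -ltnS.
  by move: djn ji jd'; clear; lia.
move=> Ew Ev; have := L_diag jd'; rewrite -(ltr_nat R) => Lj.
have : (v j - w j) * (lam - (L j j)%:R) = 0 by lra.
move=> /eqP; rewrite mulf_eq0 [X in _ || X]subr_eq0 (gt_eqF Lj) orbF subr_eq0.
by move/eqP.
Qed.

(** The deviation from the eigenrow vanishes in the last coordinate.  Below it, each
    coordinate is contracted by the ratio of a diagonal entry to the dominant one, up to
    terms from higher coordinates that already tend to 0. *)
Lemma power_iteration (a : nat -> nat -> nat) (v : nat -> R) :
  (forall k j, (j <= d)%N -> a k.+1 j = (\sum_(i < d.+1) a k i * L i j)%N) ->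
  (0 < d)%N -> eigenrow v -> v d = 1 -> forall j, (j <= d)%N ->
  (fun k => (a k j)%:R / lam ^+ k) @ \oo --> (a 0 d)%:R * v j.
Proof.
move=> a_rec d0 v_eig vd.
have lam0 : 0 < lam by rewrite ltr0n; exact: leq_ltn_trans (L_diag d0).
(* e k is the deviation of the normalized row a k from its limit. *)
pose e k j := (a k j)%:R / lam ^+ k - (a 0%N d)%:R * v j.
have e_rec k j : (j <= d)%N -> e k.+1 j = \sum_(i < d.+1) e k i * (L i j)%:R / lam.
  move=> jd; rewrite -big_distrl /=.
  have -> : \sum_(i < d.+1) e k i * (L i j)%:R =
    (a k.+1 j)%:R / lam ^+ k - (a 0%N d)%:R * (lam * v j).
    rewrite a_rec // -v_eig // natr_sum big_distrl big_distrr -sumrB /=.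
    by apply: eq_bigr => i _; rewrite natrM /e mulrBl mulrAC mulrA.
  by rewrite /e exprS; field; rewrite ?expf_neq0 gt_eqF.
have ed k : e k d = 0.
  elim: k => [|k IH]; first by rewrite /e expr0 divr1 vd mulr1 subrr.
  rewrite e_rec // big1 // => i _; have [->|id] := eqVneq (i : nat) d.
    by rewrite IH !mul0r.
  by rewrite L_trig ?mulr0 ?mul0r // ltn_neqAle id -ltnS /=.
suff H n j : (d - j < n)%N -> (j <= d)%N -> e ^~ j @ \oo --> 0.
  move=> j jd; have := H _ _ (leqnn _) jd.
  move=> /(cvgD (cvg_cst ((a 0%N d)%:R * v j)) ); rewrite addr0.
  apply: cvg_trans; apply: near_eq_cvg; apply: nearW => k /=.
  by rewrite /e addrC subrK.
elim: n j => // n IH j djn jd.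
have [->|jd'] := eqVneq j d; first by under eq_fun do rewrite ed; exact: cvg_cst.
have {}jd' : (j < d)%N by rewrite ltn_neqAle jd'.
have Lj : (L j j)%:R < lam by rewrite ltr_nat L_diag.
apply: (@contraction_cvg0 _ (fun k => \sum_(i < d.+1 | (j < i)%N) e k i * ((L i j)%:R / lam)) ((L j j)%:R / lam)).
- by rewrite divr_ge0 //= ltr_pdivrMr // mul1r.
- move=> k; rewrite e_rec // -big_distrl /= triangular_sum // mulrDl.
  rewrite big_distrl /=; congr (_ + _); first by rewrite -[LHS]mulrA [LHS]mulrC.
  by apply: eq_bigr => i _; rewrite mulrA.
have Z : \sum_(i < d.+1 | (j < i)%N) (0 : R) = 0 by rewrite big1.
rewrite -[X in _ --> X]Z.
apply: (cvg_sumr (f := fun (i : 'I_d.+1) k => e k i * ((L i j)%:R / lam)) (l := fun=> 0)) => i ji; rewrite -[X in _ --> X](mul0r ((L i j)%:R / lam)).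
apply: cvgMl; apply: IH; last by rewrite -ltnS.
by move: djn ji jd'; clear; lia.
Qed.

(** The dominant eigenspace is a line, so a matrix commuting with L acts on it by a scalar,
    which is read off the last coordinate. *)
Lemma eigenrow_involution (v : nat -> R) :
  (forall j i, (j <= d)%N ->
    \sum_(k < d.+1) (L j k)%:R * ((-1) ^+ k * 'C(k, i)%:R)
    = (-1) ^+ j * (\sum_(k < d.+1) 'C(j, k) * L k i)%:R :> R) ->
  eigenrow v -> forall i, (i <= d)%N ->
  \sum_(j < d.+1) v j * ((-1) ^+ j * 'C(j, i)%:R) = (-1) ^+ d * v i.
Proof.
move=> L_inv v_eig; pose w i : R := \sum_(j < d.+1) v j * ((-1) ^+ j * 'C(j, i)%:R).
pose u i := (-1) ^+ d * v i.
have u_eig : eigenrow u.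
  move=> j jd; rewrite /u mulrCA -v_eig // big_distrr /=.
  by apply: eq_bigr => i _; rewrite mulrA.
apply: (eigenrow_unique (v := w)) => // [k kd|]; last first.
  rewrite /w (bigD1 ord_max) //= binn mulr1 mulrC big1 ?addr0 // => j jd.
  rewrite bin_small ?mulr0 // ltn_neqAle -ltnS ltn_ord andbT.
  by apply: contra jd => /eqP jd; apply/eqP/val_inj.
under eq_bigr do rewrite big_distrl.
rewrite exchange_big /= big_distrr /=.
transitivity (\sum_(j < d.+1) v j * \sum_(i < d.+1) (L j i)%:R * ((-1) ^+ i * 'C(i, k)%:R)).
  apply: eq_bigr => j _; rewrite L_inv -1?ltnS // natr_sum !big_distrr /=.
  by apply: eq_bigr => i _; rewrite natrM !mulrA.
under [X in X = _]eq_bigr do rewrite big_distrr.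
rewrite exchange_big /=; apply: eq_bigr => i _.
rewrite [RHS]mulrA -v_eig -1?ltnS // big_distrl /=.
by apply: eq_bigr => j _; exact: mulrA.
Qed.

End PowerIteration.

(** * Continuity of the roots of monic polynomials *)

Section RootContinuity.
Variable K : numClosedFieldType.

Lemma geometric_mean_bound (s : seq K) : s != [::] ->
  (forall x, x \in s -> 0 <= x) ->
  exists2 x, x \in s & x ^+ size s <= \prod_(y <- s) y.
Proof.
elim: s => // a [|b s] IH _ s0.
  by exists a; rewrite ?mem_seq1 // big_seq1 expr1.
have [x xs|x xs x_le] := IH isT; first by rewrite s0 // inE xs orbT.
have a0 : 0 <= a by rewrite s0 // mem_head.
have x0 : 0 <= x by rewrite s0 // inE xs orbT.
rewrite big_cons; set n := size (b :: s) in x_le *.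
have [ax|/ltW xa] := real_leP (ger0_real a0) (ger0_real x0).
  exists a; rewrite ?mem_head // [_ ^+ _]exprS ler_wpM2l //.
  by apply: le_trans x_le; rewrite lerXn2r.
exists x; first by rewrite inE xs orbT.
by rewrite [_ ^+ _]exprS ler_pM // exprn_ge0.
Qed.

(** The product of the distances from w to the roots is |f(w)|, so one of them is at most
    the geometric mean. *)
Lemma near_root (f : {poly K}) n w : f \is monic -> size f = n.+2 ->
  exists2 x, root f x & `|w - x| ^+ n.+1 <= `|f.[w]|.
Proof.
move=> fmon fsz; have [s fE] := closed_field_poly_normal f.
move: fE; rewrite (monicP fmon) scale1r => fE.
have ssz : size s = n.+1 by move: fsz; rewrite fE size_prod_XsubC => -[].
have [|y|_ /mapP[x xs ->]] := @geometric_mean_bound [seq `|w - x| | x <- s].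
- by rewrite -size_eq0 size_map ssz.
- by move=> /mapP[x _ ->].
rewrite size_map ssz big_map => x_le; exists x.
  by rewrite fE root_prod_XsubC.
apply: le_trans x_le _; rewrite fE horner_prod normr_prod.
by under [X in _ <= X]eq_bigr do rewrite hornerXsubC.
Qed.

Lemma cvg_horner (f : nat -> {poly K}) (p : {poly K}) n w :
  (forall k, (size (f k) <= n)%N) -> (size p <= n)%N ->
  (forall i, (fun k => (f k)`_i) @ \oo --> p`_i) ->
  (fun k => (f k).[w]) @ \oo --> p.[w].
Proof.
move=> fn pn fp; rewrite (horner_coef_wide w pn).
under eq_fun do rewrite (horner_coef_wide w (fn _)).
by apply: cvg_sumr => i _; apply: cvgMl.
Qed.

(** The coefficients of the quotient are given by synthetic division, from the top degree
    downwards. *)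
Lemma cvg_quotient (f g : nat -> {poly K}) (p q : {poly K}) (z : nat -> K) w n :
  (forall k, f k = ('X - (z k)%:P) * g k) -> p = ('X - w%:P) * q ->
  (forall k, (size (g k) <= n)%N) -> (size q <= n)%N ->
  (forall i, (fun k => (f k)`_i) @ \oo --> p`_i) -> z @ \oo --> w ->
  forall i, (fun k => (g k)`_i) @ \oo --> q`_i.
Proof.
move=> fE pE gn qn fp zw.
have coefE (a : K) (h : {poly K}) i : h`_i = (('X - a%:P) * h)`_i.+1 + a * h`_i.+1.
  by rewrite mulrBl coefB coefXM coefCM /= subrK.
suff H l i : (n - i <= l)%N -> (fun k => (g k)`_i) @ \oo --> q`_i.
  by move=> i; exact: H (leqnn _).
elim: l i => [|l IH] i il.
  rewrite leqn0 subn_eq0 in il; rewrite nth_default ?(leq_trans qn) //.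
  under eq_fun do rewrite nth_default ?(leq_trans (gn _)) //.
  exact: cvg_cst.
rewrite (coefE w) -pE.
rewrite (_ : (fun k => (g k)`_i) = fun k => (f k)`_i.+1 + z k * (g k)`_i.+1).
  2: by apply/funext => k; rewrite (coefE (z k)) -fE.
apply: cvgD => //; apply: cvgM => //; apply: IH.
by rewrite subnS; move: il; case: (n - i)%N.
Qed.

(** Some roots of the f k converge to a given root of p.  Dividing by the corresponding
    linear factors preserves convergence, so the remaining roots follow by induction. *)
Lemma monic_roots_continuous d (f : nat -> {poly K}) (p : {poly K}) :
  (forall k, f k \is monic) -> (forall k, size (f k) = d.+1) ->
  p \is monic -> size p = d.+1 ->
  (forall i, (fun k => (f k)`_i) @ \oo --> p`_i) ->
  exists (z : nat -> d.-tuple K) (w : d.-tuple K),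
    [/\ forall k, f k = \prod_(x <- z k) ('X - x%:P),
        p = \prod_(x <- w) ('X - x%:P)
      & forall i, (fun k => tnth (z k) i) @ \oo --> tnth w i].
Proof.
have mon1 (h : {poly K}) : h \is monic -> size h = 1%N -> h = 1.
  move=> /monicP hl hs; rewrite /lead_coef hs /= in hl.
  by rewrite (size1_polyC (eq_leq hs)) hl.
elim: d f p => [|d IH] f p fmon fsz pmon psz fp.
  exists (fun=> [tuple]), [tuple]; split=> [k||[]//].
    by rewrite big_nil; exact: mon1.
  by rewrite big_nil; exact: mon1.
have [w0 pw0] : exists w, root p w by apply/closed_rootP; rewrite psz.
have close k : exists x, root (f k) x /\ `|w0 - x| ^+ d.+1 <= `|(f k).[w0]|.
  by have [x fx x_le] := near_root w0 (fmon k) (fsz k); exists x.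
have [z0 Hz0] := choice close.
have z0w : z0 @ \oo --> w0.
  apply/cvgrPdist_lt => /= eps eps0.
  have : (fun k => (f k).[w0]) @ \oo --> p.[w0].
    by apply: (@cvg_horner _ _ d.+2) => // [k|]; rewrite ?fsz ?psz.
  rewrite (eqP (pw0 : p.[w0] == 0)) => /cvgr0Pnorm_lt/(_ _ (exprn_gt0 d.+1 eps0)).
  apply: filterS => k fk; rewrite -(ltr_pXn2r (n := d.+1)) ?nnegrE ?(ltW eps0) //.
  exact: le_lt_trans (Hz0 k).2 fk.
have factor k : exists h, f k = ('X - (z0 k)%:P) * h.
  by have /factor_theorem[h ->] := (Hz0 k).1; exists h; rewrite mulrC.
have [g gE] := choice factor.
have [q qE] : exists q, p = ('X - w0%:P) * q.
  by have /factor_theorem[h ->] := pw0; exists h; rewrite mulrC.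
have quo (h h' : {poly K}) x : h = ('X - x%:P) * h' -> h \is monic ->
    size h = d.+2 -> h' \is monic /\ size h' = d.+1.
  move=> ->; rewrite monicMl ?monicXsubC // => h'mon.
  by rewrite size_Mmonic ?polyXsubC_eq0 // size_XsubC add2n => -[].
have gmon k := (quo _ _ _ (gE k) (fmon k) (fsz k)).1.
have gsz k := (quo _ _ _ (gE k) (fmon k) (fsz k)).2.
have [qmon qsz] := quo _ _ _ qE pmon psz.
have gq : forall i, (fun k => (g k)`_i) @ \oo --> q`_i.
  by apply: (cvg_quotient (n := d.+1) gE qE) => // [k|]; rewrite ?gsz ?qsz.
have [z [w [zE wE zw]]] := IH g q gmon gsz qmon qsz gq.
exists (fun k => [tuple of z0 k :: z k]), [tuple of w0 :: w]; split=> [k||i].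
- by rewrite big_cons gE zE.
- by rewrite big_cons qE wE.
have [j ->|->] := unliftP ord0 i.
  by rewrite tnthS; under eq_fun do rewrite tnthS; exact: zw.
by rewrite tnth0; under eq_fun do rewrite tnth0.
Qed.

End RootContinuity.

(** * The sphere in the coordinate 1/t *)

Section ComplexPlane.
Variable R : realType.
Local Notation toC := (real_complex R).
Local Notation ReC := (@complex.Re R).
Local Notation ImC := (@complex.Im R).

Lemma real_complex_continuous : continuous (fun x : R => toC x : Cx R).
Proof.
move=> x; apply/(@cvgrPdist_lt (Cx R) (Cx R)) => /= eps eps0.
have eE : toC (ReC eps) = eps by rewrite RRe_real // gtr0_real.
have e0 : 0 < ReC eps by rewrite -ltcR eE.
have /cvgrPdist_lt/(_ _ e0) := @cvg_id _ (nbhs x); apply: filterS => y.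
by rewrite -rmorphB normc_def /= expr0n addr0 sqrtr_sqr -eE ltcR.
Qed.

Lemma norm_lt_nat (z : Cx R) : exists M : nat, `|z| < M%:R.
Proof.
exists (Num.bound (ReC `|z|)).
have -> : `|z| = toC (ReC `|z|) by rewrite RRe_real // normr_real.
have z0 : 0 <= ReC `|z| by rewrite -ler0c RRe_real ?normr_real.
have := archi_boundP z0; rewrite -ltcR rmorph_nat => /lt_le_trans; apply.
by rewrite /= lexx.
Qed.

(** Neighbourhoods of infinity on the sphere are defined by compact sets; boundedness
    is what makes them contain the exterior of a disc. *)
Lemma compact_bounded_nat (A : set (Cx R)) : compact A ->
  exists M : nat, forall z, A z -> `|z| < M%:R.
Proof.
move=> /compact_near_coveringP/(_ nat \oo (fun n z => `|z| < n%:R)) H.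
have [|M _ HM] := H _ _; last by exists M => z; exact: (HM M (leqnn M)).
move=> z _; have [M] := norm_lt_nat (`|z| + 1).
rewrite ger0_norm ?addr_ge0 // => zM.
exists ([set y | `|z - y| < 1], [set n | (M <= n)%N]) => /=.
  split; last by exists M.
  have := @nbhsx_ballx _ (Cx R) z 1 ltr01; apply: filterS => y.
  by rewrite -ball_normE.
case=> y n [/= zy Mn]; apply: (@le_lt_trans _ _ (`|z| + 1)).
  rewrite -[y](subrK z) addrC; apply: le_trans (ler_normD _ _) _.
  by rewrite lerD2l distrC ltW.
by apply: lt_le_trans zM _; rewrite ler_nat.
Qed.

Lemma complex_pair_continuous :
  continuous (fun ab : R * R => toC ab.1 + toC ab.2 * 'i : Cx R).
Proof.
move=> ab; apply: (@cvgD (Cx R) (Cx R)).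
  apply: continuous_cvg; first exact: real_complex_continuous.
  exact: cvg_fst.
apply: (@cvgMl (Cx R)).
apply: continuous_cvg; first exact: real_complex_continuous.
exact: cvg_snd.
Qed.

(** A closed square around the point, as the image of a product of two segments. *)
Lemma locally_compactC : locally_compact [set: Cx R].
Proof.
move=> x _; rewrite withinET.
pose U := (fun ab : R * R => toC ab.1 + toC ab.2 * 'i : Cx R) @`
  (`[ReC x - 1, ReC x + 1] `*` `[ImC x - 1, ImC x + 1]).
have Ucpt : compact U.
  apply: continuous_compact; first exact/continuous_subspaceT/complex_pair_continuous.
  by apply: compact_setX; exact: segment_compact.
exists U; last first.
  split=> //; apply: compact_closed => //; exact: norm_hausdorff.
have := @nbhsx_ballx _ (Cx R) x 1 ltr01; apply: filterS => y.
rewrite -ball_normE /= => xy; exists (ReC y, ImC y) => /=; last first.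
  by rewrite [RHS]complexE complexiE mulrC.
have Re_bound (u : Cx R) : `|u| < 1 -> `|ReC u| < 1.
  by move=> u1; rewrite -ltcR; apply: le_lt_trans u1; exact: normc_ge_Re.
have ReB (u v : Cx R) : ReC (u - v) = ReC u - ReC v by case: u v => [? ?] [? ?].
have ImB (u v : Cx R) : ImC (u - v) = ImC u - ImC v by case: u v => [? ?] [? ?].
split; rewrite in_itv /= -ler_distlC ltW //; first by rewrite -ReB Re_bound.
rewrite -ImB -normrN -ReiNIm complexiE; apply: Re_bound.
by rewrite normrM normCi mulr1.
Qed.

Lemma sphere_hausdorff : hausdorff_space (sphere R).
Proof.
apply: one_point_compactification_hausdorff; first exact: locally_compactC.
exact: norm_hausdorff.
Qed.

(** Passage from s = 1/t to t, with 0 sent to infinity. *)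
Definition sphere_inv (z : Cx R) : sphere R :=
  if z == 0 then None else Some z^-1.

Lemma sphere_inv_continuous (z : nat -> Cx R) w : z @ \oo --> w ->
  (fun k => sphere_inv (z k)) @ \oo --> sphere_inv w.
Proof.
move=> zw; rewrite {2}/sphere_inv; have [w0|w0] := eqVneq w 0.
  move=> U [C [Ccpt _] CU] /=.
  have [M CM] := compact_bounded_nat Ccpt.
  have e0 : 0 < (M.+1%:R : Cx R)^-1 by rewrite invr_gt0 ltr0n.
  have : z @ \oo --> (0 : Cx R) by rewrite -w0.
  move=> /(@cvgr0Pnorm_lt (Cx R) (Cx R))/(_ _ e0); apply: filterS => k zk.
  apply: CU; rewrite /sphere_inv; case: eqP => [_|/eqP z0]; first by right.
  left; exists (z k)^-1 => // /CM; rewrite normfV => zM.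
  have {}zM : `|z k|^-1 < M.+1%:R by apply: lt_le_trans zM _; rewrite ler_nat.
  have : M.+1%:R < `|z k|^-1.
    by rewrite -[ltLHS]invrK ltf_pV2 // posrE ?normr_gt0.
  by move=> /(lt_trans zM); rewrite ltxx.
have zV : (fun k => (z k)^-1) @ \oo --> w^-1 by exact: cvgV.
have zn0 : \forall k \near \oo, z k != 0 by exact: cvgr_neq0 zw w0.
move=> U /= /zV; apply: filterS2 zn0 => k z0 Uz.
by rewrite /= /sphere_inv (negPf z0).
Qed.

(** In the coordinate s = 1/t the Moebius transformation is the affine reflection
    s |-> - 1 - s. *)
Lemma mobius_sphere_inv z : mobius (sphere_inv z) = sphere_inv (- 1 - z).
Proof.
rewrite /sphere_inv; have [->|z0] := eqVneq z 0.
  by rewrite subr0 oppr_eq0 oner_eq0 invrN1.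
rewrite /mobius; have [->|z1] := eqVneq z (-1).
  by rewrite invrN1 eqxx opprK addNr eqxx.
have zi : (z^-1 == -1) = false.
  by apply/negP => /eqP zi; case/eqP: z1; rewrite -[z]invrK zi invrN1.
have z2 : -1 - z != 0 by rewrite subr_eq0 eq_sym.
rewrite zi (negPf z2); congr Some; field.
by rewrite z2 z0 addrC addr_eq0.
Qed.

Lemma perm_finite_points (w : seq (sphere R)) :
  perm_eq w (map Some (finite_points w) ++ nseq (size w - size (finite_points w)) None).
Proof.
elim: w => // -[a|] w IH; first by rewrite /= perm_cons.
rewrite [size _]/= [finite_points _]/= subSn /=; last first.
  by rewrite /finite_points size_pmap count_size.
rewrite perm_sym (perm_catCA _ [:: None]) perm_cons perm_sym.
exact: IH.
Qed.

Lemma sphere_roots_perm d (p : {poly Cx R}) (w w' : d.-tuple (sphere R)) :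
  sphere_roots p w -> sphere_roots p w' -> perm_eq w w'.
Proof.
rewrite /sphere_roots => pw; rewrite (eqp_ltrans pw) => ww'.
have {ww'} fin : perm_eq (finite_points w) (finite_points w').
  apply: prod_XsubC_eq; apply/eqP; rewrite -eqp_monic //; exact: monic_prod_XsubC.
rewrite (perm_trans (perm_finite_points w)) // perm_sym.
rewrite (perm_trans (perm_finite_points w')) // !size_tuple (perm_size fin).
by rewrite perm_cat2r perm_sym perm_map.
Qed.

Lemma size_prod_reverse (F : idomainType) (s : seq F) :
  (size (\prod_(x <- s) (1 - x *: 'X)%R : {poly F})%R <= (size s).+1)%N.
Proof.
elim: s => [|x s IH]; first by rewrite big_nil size_poly1.
rewrite big_cons; apply: leq_trans (size_polyMleq _ _) _.
have lin : (size (1 - x *: 'X : {poly F})%R <= 2)%N.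
  apply: leq_trans (size_polyD _ _) _; rewrite geq_max size_poly1 size_polyN /=.
  by apply: leq_trans (size_scale_leq _ _) _; rewrite size_polyX.
by have := leq_add lin IH; rewrite /=; lia.
Qed.

Lemma prod_reverse (F : idomainType) (s : seq F) i : (i <= size s)%N ->
  (\prod_(x <- s) (1 - x *: 'X))`_(size s - i) = (\prod_(x <- s) ('X - x%:P))`_i.
Proof.
elim: s i => [|x s IH] i /=; first by rewrite leqn0 => /eqP ->; rewrite !big_nil.
have szQ := size_prod_reverse s.
rewrite !big_cons mulrBl mul1r coefB -scalerAl coefZ mulrBl coefB.
rewrite !coefXM coefCM subn_eq0.
case: i => [|i] is_; first by rewrite subn0 /= nth_default // -(IH 0%N) // subn0.
rewrite subSS; move: is_; rewrite leq_eqVlt => /orP[/eqP[->]|is_].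
  rewrite leqnn mulr0 subr0 subnn -(IH (size s)) // subnn.
  by rewrite [X in _ - _ * X]nth_default ?mulr0 ?subr0 // size_prod_XsubC.
rewrite leqNgt is_ /= IH //; last by rewrite ltnW.
by congr (_ - _ * _); rewrite -(IH i.+1) // subnS.
Qed.

(** Reversing the coefficients of a polynomial inverts its roots; a root 0 of r lowers the
    degree of p, that is, becomes a root of p at infinity. *)
Lemma sphere_roots_inv d (p r : {poly Cx R}) (s : d.-tuple (Cx R)) :
  r = \prod_(x <- s) ('X - x%:P) ->
  (forall i, (i <= d)%N -> p`_(d - i) = r`_i) -> (size p <= d.+1)%N ->
  sphere_roots p (map_tuple sphere_inv s).
Proof.
move=> rE pr psz; rewrite /sphere_roots.
have -> : p = \prod_(x <- s) (1 - x *: 'X).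
  apply/polyP => j; have [jd|dj] := leqP j d.
    rewrite -{1 2}(subKn jd) pr ?leq_subr // rE -prod_reverse ?size_tuple ?leq_subr //.
  rewrite !nth_default ?(leq_trans psz) //.
  by apply: leq_trans (size_prod_reverse _) _; rewrite size_tuple.
rewrite /=; elim: {p r rE pr psz} (tval s) => [|x l IH] /=.
  by rewrite !big_nil eqpxx.
rewrite big_cons /sphere_inv /finite_points /=; have [->|x0] /= := eqVneq x 0.
  by rewrite scale0r subr0 mul1r.
rewrite big_cons; apply: eqp_trans (eqp_mull _ IH) _; apply: eqp_mulr.
apply/eqpP; exists (1, - x); rewrite /= ?oner_eq0 ?oppr_eq0 ?x0 //.
rewrite scale1r scaleNr scalerBr opprB; congr (_ - _).
by rewrite -mul_polyC -polyCM divff.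
Qed.

End ComplexPlane.

(** * Roots of f-polynomials *)

(** The labellings of the roots used for p and for q differ, for each k, by a permutation.
    If no permutation matched the limits, then, the sphere being separated, each
    permutation would be excluded for large k, and all of them at once because there are
    finitely many. *)
Lemma roots_converge_unique (R : realType) d (f : nat -> {poly Cx R}) p q :
  roots_converge d f p -> roots_converge d f q -> q %= p.
Proof.
move=> [z [w [fz pw zw]]] [z' [w' [fz' qw' zw']]].
have [sig sigE] : exists sig : 'S_d, forall i, tnth w' i = tnth w (sig i).
  apply: contrapT => /forallNP nosig.
  have : \forall k \near \oo, forall sig : 'S_d,
      ~ forall i, tnth (z' k) i = tnth (z k) (sig i).
    apply: filter_forall => sig; have /existsNP[i /eqP wi] := nosig sig.
    have := @sphere_hausdorff R; rewrite open_hausdorff => /(_ _ _ wi).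
    move=> [[A B] /= [/set_mem Aw /set_mem Bw] [oA oB AB]].
    have zA : \forall k \near \oo, A (tnth (z' k) i).
      by apply: zw'; apply: open_nbhs_nbhs; split.
    have zB : \forall k \near \oo, B (tnth (z k) (sig i)).
      by apply: zw; apply: open_nbhs_nbhs; split.
    apply: filterS2 zA zB => k Ak Bk E.
    have : (A `&` B) (tnth (z k) (sig i)) by split; rewrite // -E.
    by rewrite (eqP AB).
  case/filter_ex => k; have := sphere_roots_perm (fz' k) (fz k).
  move=> /tuple_permP[sig zE] /(_ sig); apply => i.
  have /val_inj -> : val (z' k) = val [tuple tnth (z k) (sig j) | j < d] by [].
  by rewrite tnth_mktuple.
have ww' : perm_eq w' w.
  apply/tuple_permP; exists sig; congr val.
  by apply: eq_from_tnth => i; rewrite tnth_mktuple.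
rewrite /sphere_roots in qw' pw; rewrite (eqp_ltrans qw') (eqp_rtrans pw).
by rewrite (perm_big _ (perm_pmap _ ww')) eqpxx.
Qed.

Lemma reflect_poly (F : comNzRingType) d (v : nat -> F) (c : F) :
  (forall i, (i <= d)%N ->
    \sum_(j < d.+1) v j * ((-1) ^+ j * 'C(j, i)%:R) = c * v i) ->
  (\poly_(i < d.+1) v i) \Po (- 1 - 'X) = c *: \poly_(i < d.+1) v i.
Proof.
move=> v_inv; rewrite [X in X \Po _]poly_def linear_sum /=.
have expand (j : 'I_d.+1) : (- 1 - 'X) ^+ j =
    \sum_(i < d.+1) ((-1) ^+ j * 'C(j, i)%:R) *: 'X^i :> {poly F}.
  rewrite -opprD [LHS]exprNn exprDn (big_ord_widen d.+1 (fun i => 1 ^+ (j - i) * 'X^i *+ 'C(j, i))) //.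
  rewrite big_mkcond big_distrr /=; apply: eq_bigr => i _.
  have [_|ji] := leqP i.+1 j.+1; last by rewrite bin_small // !mulr0 scale0r.
  rewrite expr1n mul1r -scalerA -mul_polyC rmorphXn rmorphN1.
  by rewrite scaler_nat.
transitivity (\sum_(j < d.+1) \sum_(i < d.+1) (v j * ((-1) ^+ j * 'C(j, i)%:R)) *: 'X^i).
  apply: eq_bigr => j _; rewrite comp_polyZ comp_Xn_poly expand scaler_sumr.
  by apply: eq_bigr => i _; rewrite scalerA.
rewrite exchange_big poly_def scaler_sumr; apply: eq_bigr => i _ /=.
by rewrite -scaler_suml v_inv ?scalerA // -ltnS.
Qed.

Lemma prod_reflect (F : fieldType) (s : seq F) :
  (\prod_(x <- s) ('X - x%:P)) \Po (- 1 - 'X)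
  = (-1) ^+ size s *: \prod_(x <- s) ('X - (- 1 - x)%:P).
Proof.
elim: s => [|x s IH]; first by rewrite !big_nil comp_polyC scale1r.
rewrite !big_cons comp_polyM IH comp_polyB comp_polyX comp_polyC.
have -> : - 1 - 'X - x%:P = - ('X - (- 1 - x)%:P).
  by rewrite polyCB polyCN polyC1; ring.
by rewrite mulNr -scalerAr exprS mulN1r scaleNr.
Qed.

Lemma reflected_roots (F : fieldType) d (r : {poly F}) (s : seq F) :
  r \Po (- 1 - 'X) = (-1) ^+ d *: r -> size s = d ->
  r = \prod_(x <- s) ('X - x%:P) -> perm_eq [seq - 1 - x | x <- s] s.
Proof.
move=> + sd rE; rewrite rE prod_reflect sd => /(scalerI (negbT (signr_eq0 _ _))) E.
by apply: prod_XsubC_eq; rewrite big_map.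
Qed.

Section Complexes.
Variables (R : realType) (Phi : subdivision_method R).

Lemma fnum_gt0 (V : choiceType) (X : complex V) j :
  (0 < fnum X j)%N <-> exists2 s, s \in faces X & #|` s| = j.
Proof.
rewrite cardfs_gt0; split=> [/fset0Pn[s]|[s sX sj]].
  by rewrite in_fset_sep => /andP[sX /eqP sj]; exists s.
by apply/fset0Pn; exists s; rewrite in_fset_sep sX sj eqxx.
Qed.

Lemma dimS_attained (V : choiceType) (X : complex V) :
  exists2 s, s \in faces X & #|` s| = dimS X.
Proof.
case E : (dimS X) => [|e].
  by exists fset0; [exact: complex_fset0|rewrite cardfs0].
apply: contrapT => no; suff : (dimS X <= e)%N by rewrite E ltnn.
apply/bigmax_leqP_seq => s sX _; rewrite -ltnS ltn_neqAle; apply/andP; split.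
  by apply/eqP => se; apply: no; exists s.
rewrite -E; exact: (@leq_bigmax_seq _ _ xpredT (fun s : {fset V} => #|` s|)).
Qed.

Lemma dimS_subdivide (V : choiceType) (X : complex V) :
  dimS (subdivide Phi X) = dimS X.
Proof.
apply/eqP; rewrite eqn_leq; apply/andP; split.
  have [s sX <-] := dimS_attained (subdivide Phi X); rewrite leqNgt; apply/negP => Xs.
  have : (0 < fnum (subdivide Phi X) #|` s|)%N by apply/fnum_gt0; exists s.
  rewrite (fnum_subdivide _ _ (leqnn _)) big1 // => i _.
  by rewrite interior_count_gt ?muln0 //; apply: leq_ltn_trans Xs; rewrite -ltnS.
have [s sX sd] : exists2 s, s \in faces (subdivide Phi X) & #|` s| = dimS X.
  apply/fnum_gt0; rewrite (fnum_subdivide _ _ (leqnn _)) (bigD1 ord_max) //=.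
  rewrite addn_gt0 muln_gt0; apply/orP; left; apply/andP; split.
    exact/fnum_gt0/dimS_attained.
  exact: leq_trans (diag_count_mono Phi (leq0n _)).
rewrite -sd; exact: (@leq_bigmax_seq _ _ xpredT (fun s : {fset point R V} => #|` s|)).
Qed.

Lemma dimS_subdivide_iter (V : choiceType) (X : complex V) k :
  dimS (subdivide_iter Phi X k) = dimS X.
Proof. by elim: k => //= k <-; exact: dimS_subdivide. Qed.

Lemma fpoly_coef (V : choiceType) (X : complex V) i : (i <= dimS X)%N ->
  (fpoly R X)`_(dimS X - i) = (fnum X i)%:R.
Proof.
move=> id; rewrite /fpoly coef_sum (bigD1 (Ordinal (id : (i < (dimS X).+1)%N))) //=.
rewrite coefZ coefXn eqxx mulr1 big1 ?addr0 // => j ji.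
rewrite coefZ coefXn; case: eqP => [E|]; last by rewrite mulr0.
case/eqP: ji; apply: val_inj => /=; move: E (ltn_ord j) id; clear; lia.
Qed.

Lemma size_fpoly (V : choiceType) (X : complex V) :
  (size (fpoly R X) <= (dimS X).+1)%N.
Proof.
apply: leq_trans (size_sum _ _ _) _; apply/bigmax_leqP => j _; apply: leq_trans (size_scale_leq _ _) _.
by rewrite size_polyXn ltnS leq_subr.
Qed.

(** Normalizing by the top face number f_d makes the reversed f-polynomials monic and
    removes the dependence on X. *)
Lemma face_ratio_cvg (V : choiceType) (X : complex V) d (v : nat -> R) :
  dimS X = d -> (0 < d)%N ->
  (forall i, (i < d)%N -> (interior_count Phi i i < interior_count Phi d d)%N) ->
  eigenrow d (interior_count Phi) v -> v d = 1 ->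
  forall i, (i <= d)%N ->
    (fun k => (fnum (subdivide_iter Phi X k) i)%:R
              / (fnum (subdivide_iter Phi X k) d)%:R) @ \oo --> v i.
Proof.
move=> Xd d0 L_diag v_eig vd i id.
pose a k j := fnum (subdivide_iter Phi X k) j.
have a_rec k j : (j <= d)%N ->
    a k.+1 j = (\sum_(i < d.+1) a k i * interior_count Phi i j)%N.
  by move=> _; rewrite /a /= (fnum_subdivide _ _ (d := d)) // dimS_subdivide_iter Xd.
have lim := power_iteration (@interior_count_gt _ Phi) L_diag a_rec d0 v_eig vd.
set lam := (interior_count Phi d d)%:R in lim.
have lam0 : lam != 0 :> R by rewrite pnatr_eq0 -lt0n (leq_ltn_trans _ (L_diag 0%N d0)).
have a0 : (a 0%N d)%:R != 0 :> R.
  by rewrite pnatr_eq0 -lt0n; apply/fnum_gt0; rewrite -Xd; exact: dimS_attained.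
have -> : v i = (a 0%N d)%:R * v i / ((a 0%N d)%:R * v d).
  by rewrite vd mulr1 mulrAC divff // mul1r.
rewrite (_ : (fun k => _) =
  fun k => ((a k i)%:R / lam ^+ k) / ((a k d)%:R / lam ^+ k)); last first.
  apply/funext => k; rewrite invf_div mulrA divfK //.
  by rewrite expf_neq0.
apply: cvgM; first exact: lim.
by apply: cvgV; [rewrite vd mulr1|exact: lim].
Qed.

End Complexes.

Theorem theorem5p5 (R : realType) (n : nat) (Phi : subdivision_method R) :
  nontrivial_method Phi n ->
  exists p : {poly Cx R},
    [/\ limit_polynomial n Phi p,
        forall q : {poly Cx R}, limit_polynomial n Phi q -> q %= p
      & forall w : n.+1.-tuple (sphere R), sphere_roots p w ->
          perm_eq [seq mobius x | x <- w] w].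
Proof.
move=> nontriv; set d := n.+1.
have L_diag i : (i < d)%N -> (interior_count Phi i i < interior_count Phi d d)%N.
  by rewrite ltnS; exact: diag_count_lt.
have [v v_eig vd] := ex_eigenrow R (@interior_count_gt _ Phi) L_diag.
pose toC : {rmorphism R -> Cx R} := real_complex R.
(* r is p in the coordinate 1/t: its roots are all finite. *)
pose r : {poly Cx R} := \poly_(i < d.+1) toC (v i).
pose p : {poly Cx R} := \poly_(i < d.+1) toC (v (d - i)%N).
have rsz : size r = d.+1 by rewrite size_poly_eq // vd rmorph1 oner_neq0.
have rmon : r \is monic by rewrite monicE lead_coefE rsz coef_poly ltnSn vd rmorph1.
have pr i : (i <= d)%N -> p`_(d - i) = r`_i.
  by move=> id; rewrite !coef_poly !ltnS leq_subr id subKn.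
have psz : (size p <= d.+1)%N by exact: size_poly.
have r_sym : r \Po (- 1 - 'X) = (-1) ^+ d *: r.
  apply: reflect_poly => i id.
  have /(congr1 toC) := eigenrow_involution (@interior_count_gt _ Phi) L_diag
     (fun j k jd => count_involution Phi R k jd) v_eig id.
  rewrite rmorphM rmorphXn rmorphN1 => <-; rewrite rmorph_sum; apply: eq_bigr => j _.
  by rewrite !rmorphM rmorphXn rmorphN1 rmorph_nat.
have p_lim : limit_polynomial n Phi p.
  move=> V X Xd; pose a k j := fnum (subdivide_iter Phi X k) j.
  have ratio := face_ratio_cvg Xd (ltn0Sn n) L_diag v_eig vd.
  pose f k : {poly Cx R} := \poly_(i < d.+1) toC ((a k i)%:R / (a k d)%:R).
  have iter_d k : dimS (subdivide_iter Phi X k) = d by rewrite dimS_subdivide_iter.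
  have akd k : (a k d)%:R != 0 :> R.
    rewrite pnatr_eq0 -lt0n; apply/fnum_gt0; rewrite -(iter_d k).
    exact: dimS_attained.
  have fsz k : size (f k) = d.+1 by rewrite size_poly_eq // divff // rmorph1 oner_neq0.
  have fmon k : f k \is monic.
    by rewrite monicE lead_coefE fsz coef_poly ltnSn divff // rmorph1.
  have fr i : (fun k => (f k)`_i) @ \oo --> r`_i.
    have [id|di] := leqP i d; last first.
      rewrite nth_default ?rsz //; under eq_fun do rewrite nth_default ?fsz //.
      exact: cvg_cst.
    rewrite coef_poly ltnS id; under eq_fun do rewrite coef_poly ltnS id.
    apply: continuous_cvg; first exact: real_complex_continuous.
    exact: ratio.
  have [z [w [fz rw zw]]] := monic_roots_continuous fmon fsz rmon rsz fr.
  exists (fun k => map_tuple (@sphere_inv R) (z k)), (map_tuple (@sphere_inv R) w).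
  split=> [k||i].
  - pose X' := subdivide_iter Phi X k.
    have akdC : (a k d)%:R != 0 :> Cx R by rewrite pnatr_eq0 -(pnatr_eq0 R).
    suff : sphere_roots ((a k d)%:R^-1 *: fpoly R X') (map_tuple (@sphere_inv R) (z k)).
      by apply: eqp_trans; rewrite eqp_sym eqp_scale // invr_eq0.
    apply: (sphere_roots_inv (fz k)) => [i id|].
      have E : (fpoly R X')`_(d - i) = (a k i)%:R.
        by rewrite -(iter_d k) fpoly_coef // iter_d.
      rewrite coefZ E coef_poly ltnS id.
      by rewrite rmorphM fmorphV !rmorph_nat mulrC.
    apply: leq_trans (size_scale_leq _ _) _.
    by rewrite -(iter_d k) size_fpoly.
  - exact: (sphere_roots_inv rw).
  rewrite tnth_map; under eq_fun do rewrite tnth_map.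
  exact: sphere_inv_continuous.
exists p; split=> // [q q_lim|w pw].
  apply: roots_converge_unique (p_lim _ _ (dimS_std n)) (q_lim _ _ (dimS_std n)).
(* The roots of r are symmetric under the reflection, which becomes the Moebius
   transformation in the coordinate t. *)
have [s rs] := closed_field_poly_normal r.
move: rs; rewrite (monicP rmon) scale1r => rs.
have sd : size s == d by have := rsz; rewrite rs size_prod_XsubC => -[->].
have s_sym := reflected_roots r_sym (eqP sd) rs.
have ws := sphere_roots_perm pw (@sphere_roots_inv R d p r (Tuple sd) rs pr psz).
apply: perm_trans (perm_map _ ws) _; rewrite perm_sym (perm_trans ws) //=.
rewrite -map_comp (eq_map (@mobius_sphere_inv R)).
by rewrite (map_comp (@sphere_inv R) (fun x => - 1 - x)) perm_map // perm_sym.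
Qed.
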